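(* There exist universal positive constants $D, K_1, K_2, K_3$ such that the following holds. Let $p,n,s\in\mathbb{N}$, set $d = \nu_{\mathcal{H}} \vee \lceil D\rceil$, and suppose $1 \leq s < \sqrt{p}$ and $\log\left(1+\frac{p}{s^2}\right) \leq K_3^2 d$. Set $$\tau(p,s,n)^2 = \frac{s\sqrt{\nu_{\mathcal{H}} \log\left(1+\frac{p}{s^2}\right)}}{n}.$$ If $\eta\in(0,1)$, then there exists $C_\eta>0$ depending only on $\eta$ such that for all $C > C_\eta$ we have $$P_0\left\{T_r(d) > C K_1 n\,\tau(p,s,n)^2\right\} + \sup_{\substack{f\in\mathcal{F}_s, \\ \|f\|_2 \geq C\tau(p,s,n)}} P_f\left\{T_r(d) \leq C K_1 n\,\tau(p,s,n)^2\right\} \leq \eta,$$ where $r = K_2\left(d\log\left(1+\frac{p}{s^2}\right)\right)^{1/4}$.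
   Context: Notation: $[p]=\{1,\dots,p\}$, $a\vee b=\max\{a,b\}$. A universal constant is an absolute constant not depending on any problem parameter. Model: one observes the $p$-dimensional Gaussian white noise model $dY_x = f(x)\,dx + \frac{1}{\sqrt n}\,dB_x$, $x\in[0,1]^p$. $P_f$ denotes the law of the observation when the signal is $f$, and $P_0$ the law when $f\equiv 0$. $\|\cdot\|_2$ is the $L^2([0,1]^p)$ norm. Function space: $\mathcal{H}\subset L^2([0,1])$ is a reproducing kernel Hilbert space (RKHS) whose kernel admits a Mercer expansion. Let $\mathbf 1$ be the constant function one and $\mathcal{H}_0 := \mathcal{H}\cap \mathrm{span}\{\mathbf 1\}^\perp$ (orthogonality in $L^2([0,1])$), also an RKHS, with eigenfunctions $\{\psi_k\}_{k\ge1}$ orthonormal in $L^2([0,1])$ and corresponding eigenvalues $\mu_1\ge\mu_2\ge\dots\ge0$ in the Mercer expansion of its kernel, so that $\|g\|_{\mathcal{H}_0}^2=\sum_{k\ge1}\mu_k^{-1}\langle g,\psi_k\rangle_{L^2}^2$. It is assumed that $\mu_1=1$. Parameter space: for $S\subset[p]$, $\mathcal{H}_S := \{f(x)=\sum_{j\in S} f_j(x_j): f_j\in\mathcal{H}_0,\ \|f_j\|_{\mathcal{H}_0}\le 1 \text{ for all } j\in S\}$, and $\mathcal{F}_s := \bigcup_{S\subset[p],\,|S|\le s}\mathcal{H}_S$. Truncation level: $\nu_{\mathcal{H}}=\nu_{\mathcal{H}}(p,s,n)$ is the smallest positive integer $\nu$ with $\mu_\nu \le \frac{\sqrt{\nu\log(1+p/s^2)}}{n}$.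 Test statistic: for $k\in\mathbb{N}$, $j\in[p]$ let $X_{k,j} := \int_{[0,1]^p}\psi_k(x_j)\,dY_x$; under $P_f$ these are independent with $X_{k,j}\sim N(\theta_{k,j}, n^{-1})$, $\theta_{k,j}=\int_0^1\psi_k(t)f_j(t)\,dt$. For $d\in\mathbb{N}$ and $r\ge0$, let $E_j(d):= n\sum_{k\le d}X_{k,j}^2$, $$T_r(d) := \sum_{j=1}^p (E_j(d)-\alpha_r(d))\mathbbm{1}_{\{E_j(d)\ge d+r^2\}},\qquad \alpha_r(d):=\frac{E\left(\|g\|^2\mathbbm{1}_{\{\|g\|^2\ge d+r^2\}}\right)}{P\{\|g\|^2\ge d+r^2\}},\quad g\sim N(0,I_d).$$ *)

(* Defs.v *)
From HB Require Import structures.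
From mathcomp Require Import all_boot all_order all_algebra.
From mathcomp Require Import all_classical all_reals all_analysis.

Set Implicit Arguments.
Unset Strict Implicit.
Unset Printing Implicit Defensive.
Import Order.TTheory GRing.Theory Num.Theory.
Import numFieldNormedType.Exports.

Local Open Scope classical_set_scope.
Local Open Scope ring_scope.

Section product_probability.
Context (R : realType) (d : measure_display) (T : measurableType d).

Definition tuple_cons (n : nat) (x : T * n.-tuple T) : n.+1.-tuple T :=
  [the n.+1.-tuple T of x.1 :: x.2].

Lemma measurable_tuple_cons (n : nat) :
  measurable_fun [set: T * n.-tuple T] (@tuple_cons n).
Proof. by apply: measurable_cons; [exact: measurable_fst|exact: measurable_snd]. Qed.

HB.instance Definition _ (n : nat) :=
  @isMeasurableFun.Build _ _ _ _ (@tuple_cons n) (@measurable_tuple_cons n).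

(* The n-fold product of P, obtained by transporting the binary products of the
   library along the bijection between T * T^n and T^(n+1). *)
Fixpoint product_prob (P : probability T R) (n : nat) :
    probability (n.-tuple T) R :=
  match n with
  | 0 => \d_ [tuple]
  | m.+1 => distribution (P \x product_prob P m)%E (@tuple_cons m)
  end.

End product_probability.

Section L2.
Context (R : realType) (d : measure_display) (T : measurableType d).
Variable m : {measure set T -> \bar R}.

Definition square_integrable (f : T -> R) : Prop := f \in Lfun m 2%:E.

Definition L2_inner (f g : T -> R) : R := \int[m]_x (f x * g x).

Definition L2_norm (f : T -> R) : \bar R := 'N[m]_2%:E [EFin \o f].

Definition orthonormal (I : eqType) (phi : I -> T -> R) : Prop :=
  (forall i, square_integrable (phi i)) /\
  (forall i j, L2_inner (phi i) (phi j) = (i == j)%:R).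

End L2.

Section measures.
Variable R : realType.

(* Functions on [0, 1] (resp. [0, 1]^p) are total functions on R (resp. R^p) of
   which only the restriction to [0, 1] (resp. [0, 1]^p) matters; the Lebesgue
   measures below are carried by these sets. *)
Definition lebesgue01 : probability (measurableTypeR R) R :=
  uniform_prob (@ltr01 R).

Definition lebesgue_cube (p : nat) :
    probability (p.-tuple (measurableTypeR R)) R :=
  product_prob lebesgue01 p.

Definition std_gaussian (m : nat) :
    probability (m.-tuple (measurableTypeR R)) R :=
  product_prob (normal_prob (0 : R) 1 : probability (measurableTypeR R) R) m.

End measures.

Section white_noise.
Variables (R : realType) (p : nat).

(* A realization of the observation Y is identified with the functional
   phi |-> \int_([0, 1]^p) phi(x) dY_x on test functions phi in L^2([0, 1]^p);
   values at other phi are irrelevant. *)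
Definition test_function : Type := p.-tuple (measurableTypeR R) -> R.
Definition observation : Type := test_function -> R.

Section noise.
Context (d : measure_display) (Omega : measurableType d).
Variable P : probability Omega R.

(* B phi is the Wiener integral \int_([0, 1]^p) phi(x) dB_x: it is linear in phi
   and sends orthonormal families to vectors with law N(0, I_m); equivalently,
   (B phi)_phi is a centered Gaussian process with covariance
   E (B phi B chi) = <phi, chi> in L^2([0, 1]^p). *)
Record is_white_noise (B : test_function -> Omega -> R) : Prop :=
  IsWhiteNoise {
  white_noise_measurable : forall phi,
    square_integrable (lebesgue_cube R p) phi ->
    measurable_fun [set: Omega] (B phi);
  white_noise_linear : forall (a : R) phi chi,
    square_integrable (lebesgue_cube R p) phi ->
    square_integrable (lebesgue_cube R p) chi ->
    {ae P, forall w, B (fun x => a * phi x + chi x) w = a * B phi w + B chi w};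
  white_noise_gaussian : forall (m : nat) (phi : 'I_m -> test_function),
    orthonormal (lebesgue_cube R p) phi ->
    forall A : set (m.-tuple (measurableTypeR R)), measurable A ->
    P [set w | A [tuple B (phi i) w | i < m]] = std_gaussian R m A
}.

(* dY_x = f(x) dx + n^(-1/2) dB_x *)
Definition signal_plus_noise (n : nat) (B : test_function -> Omega -> R)
    (f : test_function) (w : Omega) : observation :=
  fun phi => L2_inner (lebesgue_cube R p) phi f + B phi w / Num.sqrt n%:R.

(* P_f, the law of Y when the signal is f *)
Definition law_obs (n : nat) (B : test_function -> Omega -> R)
    (f : test_function) (A : set observation) : \bar R :=
  P [set w | A (signal_plus_noise n B f w)].

End noise.
End white_noise.

Section rkhs.
Variable R : realType.
Implicit Types (H : set (R -> R)) (ip : (R -> R) -> (R -> R) -> R).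

Definition ip_norm ip (f : R -> R) : R := Num.sqrt (ip f f).

(* H, with inner product ip, is a reproducing kernel Hilbert space contained in
   L^2([0, 1]), and K is its kernel. *)
Record is_RKHS H ip (K : R -> R -> R) : Prop := IsRKHS {
  rkhs_L2 : forall f, H f -> square_integrable (lebesgue01 R) f;
  rkhs_zero : H (fun=> 0);
  rkhs_lin : forall a f g, H f -> H g -> H (fun x => a * f x + g x);
  rkhs_ip_sym : forall f g, H f -> H g -> ip f g = ip g f;
  rkhs_ip_lin : forall a f g h, H f -> H g -> H h ->
    ip (fun x => a * f x + g x) h = a * ip f h + ip g h;
  rkhs_ip_ge0 : forall f, H f -> 0 <= ip f f;
  rkhs_ip_eq0 : forall f, H f ->
    (ip f f = 0 <-> forall x, 0 <= x <= 1 -> f x = 0);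
  rkhs_complete : forall u : nat -> R -> R, (forall i, H (u i)) ->
    (forall e, 0 < e -> exists N, forall i j, (N <= i)%N -> (N <= j)%N ->
       ip_norm ip (fun x => u i x - u j x) < e) ->
    exists2 f, H f & ip_norm ip (fun x => u i x - f x) @[i --> \oo] --> 0;
  rkhs_kernel : forall x, 0 <= x <= 1 -> H (fun y => K y x);
  rkhs_reproducing : forall f x, H f -> 0 <= x <= 1 ->
    f x = ip f (fun y => K y x)
}.

(* K(x, y) = \sum_k mu_k psi_k(x) psi_k(y). All sequences of eigenvalues and
   eigenfunctions are indexed from 0: mu k is the (k+1)-st eigenvalue. *)
Record mercer_expansion (K : R -> R -> R) (mu : nat -> R)
    (psi : nat -> R -> R) : Prop := MercerExpansion {
  mercer_orthonormal : orthonormal (lebesgue01 R) psi;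
  mercer_ge0 : forall k, 0 <= mu k;
  mercer_noninc : forall k l, (k <= l)%N -> mu l <= mu k;
  mercer_sum : forall x y, 0 <= x <= 1 -> 0 <= y <= 1 ->
    (\sum_(0 <= k < N) mu k * psi k x * psi k y) @[N --> \oo] --> K x y
}.

(* Orthogonality to the constant function one in L^2([0, 1]). Members of the
   centered space satisfy it, hence so do the eigenfunctions psi k of its kernel
   with mu k > 0; for psi k with mu k = 0 it has to be required separately, and
   it is what makes the variables \int psi_k(x_j) dY_x independent over j. *)
Definition mean_zero (f : R -> R) : Prop :=
  L2_inner (lebesgue01 R) f (fun=> 1) = 0.

Definition centered H : set (R -> R) := H `&` [set f | mean_zero f].

(* H_S and F_s, for the space H0 with inner product ip; by uniqueness of the
   RKHS of a given kernel, ip_norm ip g ^+ 2 is \sum_k <g, psi_k>^2 / mu_k. *)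
Definition additive_class H0 ip (p : nat) (S : {set 'I_p}) :
    set (test_function R p) :=
  [set f | exists2 g : 'I_p -> R -> R,
     (forall j, j \in S -> H0 (g j) /\ ip_norm ip (g j) <= 1) &
     forall x, f x = \sum_(j in S) g j (tnth x j)].

Definition sparse_additive_class H0 ip (p s : nat) : set (test_function R p) :=
  [set f | exists2 S : {set 'I_p}, (#|S| <= s)%N & additive_class H0 ip S f].

End rkhs.

Section testing.
Variable R : realType.

Definition log_term (p s : nat) : R := ln (1 + p%:R / s%:R ^+ 2).

Definition below_noise (mu : nat -> R) (p s n nu : nat) : Prop :=
  mu nu.-1 <= Num.sqrt (nu%:R * log_term p s) / n%:R.

Definition is_truncation_level (mu : nat -> R) (p s n nu : nat) : Prop :=
  [/\ (0 < nu)%N, below_noise mu p s n nu &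
      forall m, (0 < m)%N -> below_noise mu p s n m -> (nu <= m)%N].

Definition sq_norm (d : nat) (x : d.-tuple (measurableTypeR R)) : R :=
  \sum_(i < d) tnth x i ^+ 2.

(* alpha_r(d) = E (|g|^2 ; |g|^2 >= d + r^2) / P (|g|^2 >= d + r^2),
   for g ~ N(0, I_d) *)
Definition alpha (r : R) (d : nat) : R :=
  let A := [set x : d.-tuple (measurableTypeR R) | d%:R + r ^+ 2 <= sq_norm x] in
  (\int[std_gaussian R d]_(x in A) sq_norm x) / fine (std_gaussian R d A).

Section statistic.
Variables (p n : nat) (psi : nat -> R -> R).

Definition coef (Y : observation R p) (k : nat) (j : 'I_p) : R :=
  Y (fun x => psi k (tnth x j)).

Definition energy (d : nat) (Y : observation R p) (j : 'I_p) : R :=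
  n%:R * \sum_(k < d) coef Y k j ^+ 2.

Definition T_stat (r : R) (d : nat) (Y : observation R p) : R :=
  \sum_(j < p) (energy d Y j - alpha r d) *
    (d%:R + r ^+ 2 <= energy d Y j)%R%:R.

End statistic.
End testing.

(* Main.v *)
Require Import Defs.
From HB Require Import structures.
From mathcomp Require Import all_boot all_order all_algebra.
From mathcomp Require Import all_classical all_reals all_analysis.
From mathcomp Require Import measurable_realfun ring lra.

(** Write d = nu, L = ln (1 + p / s^2), rho = sqrt (d L), so that n tau^2 = s rho,
    r^2 = 49 rho and the test rejects when the statistic exceeds C s rho. Since
    D = 1, the maximum of nu and D is nu itself.

    The coefficients of the observation along the functions psi_k (x_j), k < d, are
    Gaussian and independent, because these functions are orthonormal in L^2 of the cube
    ([orthonormal_coord_test]). The statistic is then a sum over j of independent terms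
    h (E_j), with h (z) = (z - alpha) 1 {z >= d + r^2} and E_j a chi-square variable,
    noncentral for the active coordinates. Both error probabilities follow from the
    exponential Markov inequality with the same parameter l = 1 / (2 s rho), for which l
    times the threshold is C / 2; exponential moments factor over the coordinates.

    For a coordinate without signal h (E_j) is centered, so its exponential moment
    exceeds 1 by about l^2 E h^2, which is of order exp (- L) / s^2 because h vanishes
    unless a chi-square variable exceeds its mean by 49 rho ([mgf_excess]). As
    p exp (- L) <= s^2, all these coordinates together contribute a bounded factor
    ([null_budget]), and the probability of a false alarm is at most exp (O(1) - C / 2).

    For an active coordinate, h (z) >= z - alpha for every z, so the threshold can be
    dropped and the moment is an explicit Gaussian integral ([mgf_excess_shifted]). It
    costs l (alpha - d) and gains l / 2 times the energy of the observed signal. The cost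
    summed over s coordinates is bounded because alpha - d = O(rho) ([alpha_ub]), which
    itself rests on a lower bound exp (- O(L)) on the probability of exceedance, obtained
    by a second moment argument from the moment generating function of chi-square
    variables alone ([tail_lower_bound]). The energy is at least (C^2 - 1) s rho, so the
    probability of missing the signal is at most exp (O(1) + C / 2 - (C^2 - 1) / 4).

    The energy bound requires that a function g in the unit ball of the space loses at
    most mu_nu in squared L^2 norm when it is cut at frequency nu ([rkhs_ball_tail]). The
    kernel is only known through its pointwise Mercer expansion and the reproducing
    property. For finite combinations of kernel sections both norms are explicit and the
    claim follows from mu_k^2 <= mu_nu mu_k; a general g is approximated by such
    combinations that nearly minimize the distance to g, which converge to g pointwise
    and, by Fatou's lemma, in L^2. *)

Set Implicit Arguments.
Unset Strict Implicit.
Unset Printing Implicit Defensive.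
Import Order.TTheory GRing.Theory Num.Theory.
Import numFieldNormedType.Exports.
Local Open Scope classical_set_scope.
Local Open Scope ring_scope.

(** * Integrals against densities and product measures *)

Section measurable_comparisons.
Context (R : realType) (d : measure_display) (T : measurableType d).
Implicit Types f g : T -> R.

Lemma measurable_set_ler f g : measurable_fun setT f -> measurable_fun setT g ->
  measurable [set x | f x <= g x].
Proof.
move=> mf mg; rewrite -[X in measurable X]setTI.
exact: (measurable_fun_ler mf mg measurableT (Y := [set true]) I).
Qed.

Lemma measurable_set_ltr f g : measurable_fun setT f -> measurable_fun setT g ->
  measurable [set x | f x < g x].
Proof.
move=> mf mg; rewrite -[X in measurable X]setTI.
exact: (measurable_fun_ltr mf mg measurableT (Y := [set true]) I).
Qed.

End measurable_comparisons.

Section density.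
Context d (T : measurableType d) (R : realType).
Variables (mu nu : {measure set T -> \bar R}) (h : T -> R).
Hypotheses (mh : measurable_fun setT h) (h0 : forall x, 0 <= h x).
Hypothesis nuE : forall A, measurable A -> nu A = (\int[mu]_(x in A) (h x)%:E)%E.
Local Open Scope ereal_scope.
Import HBNNSimple.

Let nnsfun_density (g : {nnsfun T >-> R}) :
  \int[nu]_x (g x)%:E = \int[mu]_x ((g x)%:E * (h x)%:E).
Proof.
rewrite integralT_nnsfun sintegralE.
transitivity (\int[mu]_x (\sum_(r \in range g)
    (r%:E * ((\1_(g @^-1` [set r]) x)%:E * (h x)%:E)))).
  rewrite ge0_integral_fsum//; last 2 first.
  - move=> r; apply: measurable_funeM; apply: emeasurable_funM.
      by apply/measurable_EFinP.
    exact/measurable_EFinP.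
  - move=> r x _; rewrite muleA; apply: mule_ge0; last by rewrite lee_fin.
    exact: nnfun_muleindic_ge0.
  apply: eq_fsbigr => r /[!inE] -[x _ <-].
  rewrite ge0_integralZl//; last 3 first.
  - apply: emeasurable_funM; first exact/measurable_EFinP.
    exact/measurable_EFinP.
  - by move=> y _; rewrite -EFinM lee_fin mulr_ge0.
  - by rewrite lee_fin.
  congr (_ * _); rewrite nuE// integral_mkcond.
  apply: eq_integral => y _; rewrite patchE indicE.
  by case: ifP => _; rewrite /= ?mul1e ?mul0e.
apply: eq_integral => x _; rewrite (fimfunE g x) -fsumEFin//.
rewrite ge0_mule_fsuml.
  by apply: eq_fsbigr => r _; rewrite EFinM muleA.
by move=> r; exact: nnfun_muleindic_ge0.
Qed.

(** Both sides are continuous along increasing sequences of simple functions, so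
    the identity on measurable sets suffices. *)
Lemma ge0_integral_density (f : T -> \bar R) :
  measurable_fun setT f -> (forall x, 0 <= f x) ->
  \int[nu]_x f x = \int[mu]_x (f x * (h x)%:E).
Proof.
move=> mf f0.
pose f_ := nnsfun_approx measurableT mf.
have cf x : (EFin \o f_ ^~ x) n @[n --> \oo] --> f x.
  exact: cvg_nnsfun_approx.
have nd x m n : (m <= n)%N -> (f_ m x <= f_ n x)%R.
  by move=> mn; exact/lefP/nd_nnsfun_approx.
transitivity (limn (fun n => \int[nu]_x (f_ n x)%:E)).
  rewrite -monotone_convergence//=.
  - by apply: eq_integral => x _; apply/esym/cvg_lim => //; exact: cf.
  - by move=> n; exact/measurable_EFinP.
  - by move=> n x _; rewrite lee_fin.
  - by move=> x _ m n mn; rewrite lee_fin; exact: nd.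
transitivity (limn (fun n => \int[mu]_x ((f_ n x)%:E * (h x)%:E))).
  by apply: congr_lim; apply/funext => n; exact: nnsfun_density.
rewrite -monotone_convergence//=.
- apply: eq_integral => x _; apply/cvg_lim => //.
  by apply: cvgeMr => //; exact: cf.
- by move=> n; apply: emeasurable_funM; exact/measurable_EFinP.
- by move=> n x _; rewrite -EFinM lee_fin mulr_ge0.
- by move=> x _ m n mn; rewrite -!EFinM lee_fin ler_wpM2r// nd.
Qed.

End density.

Lemma emeasurable_prod d (T : measurableType d) (R : realType) (I : Type)
    (s : seq I) (F : I -> T -> \bar R) :
  (forall i, measurable_fun setT (F i)) ->
  measurable_fun setT (fun x => (\prod_(i <- s) F i x)%E).
Proof.
move=> mF; elim: s => [|i s IH].
  rewrite [X in measurable_fun _ X](_ : _ = cst 1%E)//.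
  by apply/funext => x; rewrite big_nil.
under eq_fun do rewrite big_cons.
exact: emeasurable_funM.
Qed.

Lemma integral_prob_cst d (T : measurableType d) (R : realType)
    (P : probability T R) (c : R) : (\int[P]_x c%:E = c%:E)%E.
Proof.
rewrite (@integral_cst _ _ _ P _ measurableT) -[RHS]mule1; congr (_ * _)%E.
exact: probability_setT.
Qed.

Section product_integral.
Context (R : realType) (d : measure_display) (T : measurableType d).
Variable P : probability T R.
Local Open Scope ereal_scope.

Lemma integral_product_prob0 (F : 0.-tuple T -> \bar R) :
  measurable_fun setT F -> \int[product_prob P 0]_x F x = F [tuple].
Proof. by move=> mF; rewrite integral_dirac// diracT mul1e. Qed.

Lemma integral_product_probS n (F : n.+1.-tuple T -> \bar R) :
  measurable_fun setT F -> (forall x, 0 <= F x) ->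
  \int[product_prob P n.+1]_x F x =
  \int[P]_a \int[product_prob P n]_x F (tuple_cons (a, x)).
Proof.
move=> mF F0; rewrite ge0_integral_distribution//.
rewrite fubini_tonelli1//; last by move=> x; exact: F0.
by apply: measurableT_comp => //; exact: measurable_tuple_cons.
Qed.

Lemma integral_prod_tnth n (F : 'I_n -> T -> \bar R) :
  (forall i, measurable_fun setT (F i)) -> (forall i x, 0 <= F i x) ->
  \int[product_prob P n]_x \prod_(i < n) F i (tnth x i) =
  \prod_(i < n) \int[P]_x F i x.
Proof.
elim: n F => [|n IH] F mF F0.
  rewrite (eq_integral (cst 1)); last by move=> x _; rewrite big_ord0.
  by rewrite integral_product_prob0 ?big_ord0.
have mp m (G : 'I_m -> T -> \bar R) : (forall i, measurable_fun setT (G i)) ->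
    measurable_fun setT (fun x : m.-tuple T => \prod_(i < m) G i (tnth x i)).
  move=> mG; apply: emeasurable_prod => i.
  by apply: measurableT_comp => //; exact: measurable_tnth.
rewrite integral_product_probS; [|exact: mp|by move=> x; exact: prode_ge0].
rewrite big_ord_recl.
rewrite -[X in _ * X]IH//.

rewrite -ge0_integralZr//; last first.
  by apply: integral_ge0 => x _; exact: prode_ge0.
apply: eq_integral => a _; rewrite -ge0_integralZl//; last 2 first.
- exact: (mp n (fun i => F (lift ord0 i))).
- by move=> x _; exact: prode_ge0.
apply: eq_integral => x _; rewrite big_ord_recl /tuple_cons /=.
by congr (_ * _); apply: eq_bigr => i _; rewrite tnthS.
Qed.

(** Blocks of coordinates are read through an index map, which avoids casts between
    tuple types whose lengths are equal but not syntactically so. *)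
Definition pick_coords m n (f : 'I_m -> 'I_n) (x : n.-tuple T) : m.-tuple T :=
  [tuple tnth x (f k) | k < m].

Lemma measurable_pick_coords m n (f : 'I_m -> 'I_n) :
  measurable_fun setT (pick_coords f).
Proof.
apply/measurable_fun_tnthP => i.
rewrite (_ : _ \o _ = fun x => tnth x (f i)); first exact: measurable_tnth.
by apply/funext => x /=; rewrite tnth_mktuple.
Qed.

(** Induction on the first block: [m.+1 + n] is convertible to [(m + n).+1], so one
    coordinate can be peeled off the product measure by Tonelli's theorem. *)
Lemma integral_pick_split m n (F : m.-tuple T -> \bar R) (G : n.-tuple T -> \bar R) :
  measurable_fun setT F -> measurable_fun setT G ->
  (forall x, 0 <= F x) -> (forall x, 0 <= G x) ->
  \int[product_prob P (m + n)]_x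
     (F (pick_coords (@lshift m n) x) * G (pick_coords (@rshift m n) x)) =
  \int[product_prob P m]_x F x * \int[product_prob P n]_x G x.
Proof.
move=> + mG + G0; elim: m F => [|m IH] F mF F0.
  rewrite integral_product_prob0// -ge0_integralZl//.
  apply: eq_integral => x _; rewrite (tuple0 (pick_coords _ x)).
  congr (_ * G _); apply: eq_from_tnth => i; rewrite tnth_mktuple.
  by congr tnth; apply: val_inj.
rewrite (@integral_product_probS (m + n)); first last.
- by move=> x; rewrite mule_ge0.
- by apply: emeasurable_funM; apply: measurableT_comp => //;
    exact: measurable_pick_coords.
have mFa a : measurable_fun setT (fun x => F (tuple_cons (a, x))).
  apply: measurableT_comp => //.
  by apply: (measurableT_comp (@measurable_tuple_cons _ _ m)) => //;
    exact: measurable_pair1.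
rewrite integral_product_probS// -ge0_integralZr//; first last.
- by apply: integral_ge0.
- by move=> a _; apply: integral_ge0.
- apply: (@measurable_fun_fubini_tonelli_F _ _ _ _ _ _
    (F \o @tuple_cons _ _ m)) => //.
  by apply: measurableT_comp => //; exact: measurable_tuple_cons.
  by move=> x; exact: F0.
apply: eq_integral => a _; rewrite -IH//.
apply: eq_integral => x _; congr (F _ * G _); apply: eq_from_tnth => i.
  case: (unliftP ord0 i) => [j|] ->.
    rewrite tnth_mktuple /tuple_cons /= tnthS tnth_mktuple.
    rewrite (_ : lshift n (lift ord0 j) = lift ord0 (lshift n j)) ?tnthS//.
    exact: val_inj.
  by rewrite tnth_mktuple /tuple_cons /= (_ : lshift n ord0 = ord0)//; apply: val_inj.
rewrite !tnth_mktuple /tuple_cons.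
by rewrite (_ : rshift m.+1 i = lift ord0 (rshift m i)) ?tnthS//; apply: val_inj.
Qed.

Lemma block_ord_subproof p d0 (j : 'I_p) (k : 'I_d0) : (j * d0 + k < p * d0)%N.
Proof.
apply: (@leq_trans (j.+1 * d0)); last by rewrite leq_mul2r ltn_ord orbT.
by rewrite mulSn addnC ltn_add2r.
Qed.

Definition block_ord p d0 (j : 'I_p) (k : 'I_d0) : 'I_(p * d0) :=
  Ordinal (block_ord_subproof j k).

Lemma integral_prod_block p d0 (F : 'I_p -> d0.-tuple T -> \bar R) :
  (forall j, measurable_fun setT (F j)) -> (forall j x, 0 <= F j x) ->
  \int[product_prob P (p * d0)]_x \prod_(j < p) F j (pick_coords (block_ord j) x) =
  \prod_(j < p) \int[product_prob P d0]_x F j x.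
Proof.
elim: p F => [|p IH] F mF F0.
  rewrite (eq_integral (cst 1)); last by move=> x _; rewrite big_ord0.
  by rewrite integral_product_prob0 ?big_ord0.
rewrite big_ord_recl -IH// -[(p.+1 * d0)%N]/(d0 + p * d0)%N -integral_pick_split//.
- apply: eq_integral => x _; rewrite big_ord_recl; congr (F _ _ * _).
    apply: eq_from_tnth => i; rewrite !tnth_mktuple; congr tnth.
    by apply: val_inj => /=; rewrite mul0n.
  apply: eq_bigr => j _; congr F; apply: eq_from_tnth => i.
  rewrite !tnth_mktuple; congr tnth; apply: val_inj => /=.
  by rewrite /bump /= add1n mulSn addnA.
- apply: emeasurable_prod => j; apply: measurableT_comp => //.
  exact: measurable_pick_coords.
- by move=> x; apply: prode_ge0.
Qed.

(** Rectangles determine a product measure, so this identifies the joint law of two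
    distinct coordinates. *)
Lemma product_prob_rectangle n (i j : 'I_n) (A B : set T) :
  i != j -> measurable A -> measurable B ->
  product_prob P n [set x | A (tnth x i) /\ B (tnth x j)] = P A * P B.
Proof.
move=> ij mA mB.
have mE : measurable [set x : n.-tuple T | A (tnth x i) /\ B (tnth x j)].
  apply: measurableI; rewrite -[X in measurable X]setTI; exact: measurable_tnth.
pose F k (x : T) : \bar R :=
  (if k == i then \1_A x else if k == j then \1_B x else 1%R)%:E.
transitivity (\int[product_prob P n]_x \prod_(k < n) F k (tnth x k)).
  transitivity (\int[product_prob P n]_x (\1_[set x : n.-tuple T | A (tnth x i) /\ B (tnth x j)] x)%:E).
    by rewrite integral_indic// setIT.
  apply: eq_integral => x _.
  rewrite (bigD1 i)// (bigD1 j) 1?eq_sym//= big1 ?mule1; last first.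
    by move=> k /andP[/negbTE ki /negbTE kj]; rewrite /F ki kj.
  rewrite /F eqxx eq_sym (negbTE ij) eqxx -EFinM !indicE -natrM mulnb.
  by congr ((nat_of_bool _)%:R%:E); apply/idP/andP; rewrite !inE.
have mF k : measurable_fun setT (F k).
  apply/measurable_EFinP; rewrite /F; case: (k == i); first exact: measurable_indic.
  by case: (k == j) => //; exact: measurable_indic.
rewrite integral_prod_tnth//; last first.
  by move=> k x; rewrite /F lee_fin; case: ifP => // _; case: ifP.
rewrite (bigD1 i)// (bigD1 j) 1?eq_sym//= big1 ?mule1; last first.
  move=> k /andP[/negbTE ki /negbTE kj]; rewrite /F ki kj.
  exact: integral_prob_cst.
by rewrite /F eqxx eq_sym (negbTE ij) eqxx !integral_indic// !setIT.
Qed.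

Lemma product_prob_tnth n (i : 'I_n) (A : set T) : measurable A ->
  product_prob P n [set x | A (tnth x i)] = P A.
Proof.
move=> mA.
have mE : measurable [set x : n.-tuple T | A (tnth x i)].
  rewrite -[X in measurable X]setTI; exact: measurable_tnth.
pose F k (x : T) : \bar R := (if k == i then \1_A x else 1%R)%:E.
transitivity (\int[product_prob P n]_x \prod_(k < n) F k (tnth x k)).
  transitivity (\int[product_prob P n]_x (\1_[set x : n.-tuple T | A (tnth x i)] x)%:E).
    by rewrite integral_indic// setIT.
  apply: eq_integral => x _.
  rewrite (bigD1 i)//= big1 ?mule1; last first.
    by move=> k /negbTE ki; rewrite /F ki.
  by rewrite /F eqxx !indicE; congr ((nat_of_bool _)%:R%:E); rewrite !in_setE.
have mF k : measurable_fun setT (F k).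
  by apply/measurable_EFinP; rewrite /F; case: (k == i) => //; exact: measurable_indic.
rewrite integral_prod_tnth//; last first.
  by move=> k x; rewrite /F lee_fin; case: ifP.
rewrite (bigD1 i)//= big1 ?mule1; last first.
  move=> k /negbTE ki; rewrite /F ki.
  exact: integral_prob_cst.
by rewrite /F eqxx !integral_indic// !setIT.
Qed.

End product_integral.

(** * Exponential moments of Gaussian vectors *)

Section sqrt_bounds.
Variable R : realType.
Implicit Types a y t : R.

Lemma invsqrt_le_expR a y : 0 < a -> expR (- (2 * y)) <= a ->
  (Num.sqrt a)^-1 <= expR y.
Proof.
move=> a0 h; rewrite -[leRHS]invrK lef_pV2 ?posrE ?invr_gt0 ?expR_gt0 ?sqrtr_gt0//.
rewrite -expRN -(@ler_sqr _ (expR (- y))) ?nnegrE ?expR_ge0 ?sqrtr_ge0//.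
by rewrite sqr_sqrtr ?(ltW a0)// -expRM_natl mulrN.
Qed.

Lemma expR_le_invsqrt a y : 0 < a -> a <= expR (- (2 * y)) ->
  expR y <= (Num.sqrt a)^-1.
Proof.
move=> a0 h; rewrite -[leLHS]invrK lef_pV2 ?posrE ?invr_gt0 ?expR_gt0 ?sqrtr_gt0//.
rewrite -expRN -(@ler_sqr _ _ (expR (- y))) ?nnegrE ?expR_ge0 ?sqrtr_ge0//.
by rewrite sqr_sqrtr ?(ltW a0)// -expRM_natl mulrN.
Qed.

(** The next three lemmas compare (1 - 2t)^(-1/2) and (1 + 2t)^(-1/2) with the
    exponential of a second-order expansion. They only rely on 1 + x <= exp x, hence
    the quadratic coefficients, which are of the right order but not optimal. *)
Lemma invsqrt_sub_ub t : 0 <= t <= 4^-1 ->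
  (Num.sqrt (1 - 2 * t))^-1 <= expR (t + 4 * t ^+ 2).
Proof.
move=> /andP[t0 t4]; apply: invsqrt_le_expR; first by lra.
have u0 : 0 < 1 + 2 * (t + 4 * t ^+ 2) by nra.
apply: (@le_trans _ _ (1 + 2 * (t + 4 * t ^+ 2))^-1).
  by rewrite expRN lef_pV2 ?posrE ?expR_gt0// expR_ge1Dx.
by rewrite -[leLHS]mulr1 ler_pdivrMl//; nra.
Qed.

(** Here 1 + x <= exp x is squared: with u = 2t + t^2 it gives
    (1 - u / 2)^2 <= exp (- u), which keeps the quadratic term that the unsquared
    bound loses. *)
Lemma invsqrt_sub_lb t : 0 <= t < 2^-1 ->
  expR (t + t ^+ 2 / 2) <= (Num.sqrt (1 - 2 * t))^-1.
Proof.
move=> /andP[t0 t2]; apply: expR_le_invsqrt; first by lra.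
have := expR_ge1Dx (- (t + t ^+ 2 / 2)); set v := expR _ => hv.
have -> : expR (- (2 * (t + t ^+ 2 / 2))) = v ^+ 2.
  by rewrite -expRM_natl; congr expR; ring.
have h1 : 0 <= 1 - (t + t ^+ 2 / 2) by nra.
apply: (@le_trans _ _ ((1 - (t + t ^+ 2 / 2)) ^+ 2)); last first.
  by rewrite ler_sqr ?nnegrE ?expR_ge0.
have := mulr_ge0 t0 (sqr_ge0 t); have := sqr_ge0 (t ^+ 2); nra.
Qed.

Lemma invsqrt_add_ub t : 0 <= t ->
  (Num.sqrt (1 + 2 * t))^-1 <= expR (- t + 2 * t ^+ 2).
Proof.
move=> t0; apply: invsqrt_le_expR; first by lra.
have u0 : 0 < 1 + 2 * (- t + 2 * t ^+ 2) by nra.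
apply: (@le_trans _ _ (1 + 2 * (- t + 2 * t ^+ 2))^-1).
  by rewrite expRN lef_pV2 ?posrE ?expR_gt0// expR_ge1Dx.
rewrite -[leLHS]mulr1 ler_pdivrMl//.
by have := mulr_ge0 t0 (sqr_ge0 t); nra.
Qed.

End sqrt_bounds.

Section gaussian.
Variable R : realType.
Local Notation gauss := (normal_prob (0 : R) 1 : probability (measurableTypeR R) R).

(** Completing the square: up to a constant factor the integrand is again a normal
    density, of variance 1 / (1 + 2t). *)
Lemma integral_normal_tilt (t m : R) : - 2^-1 < t ->
  (\int[gauss]_x (expR (- t * (m + x) ^+ 2))%:E =
   ((Num.sqrt (1 + 2 * t))^-1 * expR (- t * m ^+ 2 / (1 + 2 * t)))%:E)%E.
Proof.
move=> ht; have u0 : 0 < 1 + 2 * t by lra.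
set s := (Num.sqrt (1 + 2 * t))^-1.
have s0 : 0 < s by rewrite invr_gt0 sqrtr_gt0.
have s2 : s ^+ 2 = (1 + 2 * t)^-1 by rewrite exprVn sqr_sqrtr ?(ltW u0).
rewrite (@ge0_integral_density _ _ _ lebesgue_measure gauss (normal_pdf 0 1))//=.
- rewrite -[RHS]mule1 -(integral_normal_pdf (- 2 * t * m / (1 + 2 * t)) s).
  rewrite -ge0_integralZl; last 4 first.
  + exact: measurableT.
  + by apply/measurable_EFinP; exact: measurable_normal_pdf.
  + by move=> x _; rewrite lee_fin normal_pdf_ge0.
  + by rewrite lee_fin mulr_ge0 ?expR_ge0// ltW.
  apply: eq_integral => x _; rewrite -!EFinM !normal_pdfE ?oner_neq0 ?gt_eqF//.
  rewrite /normal_peak /normal_fun s2; congr EFin.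
  have -> : (Num.sqrt ((1 + 2 * t)^-1 * pi *+ 2))^-1 =
            s^-1 * (Num.sqrt (1 ^+ 2 * pi *+ 2))^-1 :> R.
    rewrite -s2 -!mulrnAr sqrtrM ?sqr_ge0// sqrtr_sqr gtr0_norm//.
    by rewrite invfM expr1n mul1r.
  set q := (Num.sqrt (1 ^+ 2 * pi *+ 2))^-1.
  rewrite [LHS]mulrCA -expRD.
  rewrite [RHS](_ : _ = q * (s * s^-1 * (expR (- t * m ^+ 2 / (1 + 2 * t)) *
    expR (- (x - - 2 * t * m / (1 + 2 * t)) ^+ 2 / ((1 + 2 * t)^-1 *+ 2))))); last by ring.
  rewrite divff ?gt_eqF// mul1r -expRD; congr (_ * expR _).
  by field; lra.
- exact: measurable_normal_pdf.
- by move=> x; exact: normal_pdf_ge0.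
- apply/measurable_EFinP; apply: measurableT_comp => //.
  apply: measurable_funM => //; apply: measurable_funX.
  exact: measurable_funD.
Qed.

End gaussian.
Section gaussian_vector.
Variable R : realType.

Lemma measurable_sq_norm d : measurable_fun setT (@sq_norm R d).
Proof.
apply: measurable_sum => i; apply: measurable_funX; exact: measurable_tnth.
Qed.

Definition shifted_sq_norm d (m : 'I_d -> R) (x : d.-tuple (measurableTypeR R)) : R :=
  \sum_(i < d) (m i + tnth x i) ^+ 2.

Lemma measurable_shifted_sq_norm d (m : 'I_d -> R) :
  measurable_fun setT (shifted_sq_norm m).
Proof.
apply: measurable_sum => i; apply: measurable_funX.
by apply: measurable_funD => //; exact: measurable_tnth.
Qed.

Lemma integral_std_gaussian_tilt d (t : R) (m : 'I_d -> R) : - 2^-1 < t ->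
  (\int[std_gaussian R d]_x (expR (- t * shifted_sq_norm m x))%:E =
   ((Num.sqrt (1 + 2 * t))^-1 ^+ d *
    expR (- t * (\sum_(i < d) m i ^+ 2) / (1 + 2 * t)))%:E)%E.
Proof.
move=> ht.
pose F (i : 'I_d) (y : R) : \bar R := (expR (- t * (m i + y) ^+ 2))%:E.
transitivity (\int[std_gaussian R d]_x \prod_(i < d) F i (tnth x i))%E.
  by apply: eq_integral => x _; rewrite prodEFin /shifted_sq_norm mulr_sumr expR_sum.
rewrite integral_prod_tnth//; first last.
- by move=> i x; rewrite lee_fin expR_ge0.
- move=> i; apply/measurable_EFinP; apply: measurableT_comp => //.
  apply: measurable_funM => //; apply: measurable_funX.
  exact: measurable_funD.
under eq_bigr do rewrite integral_normal_tilt//.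
rewrite prodEFin big_split/= prodr_const card_ord -expR_sum mulr_sumr mulr_suml.
by [].
Qed.

Lemma mgf_sq_norm d (t : R) : t < 2^-1 ->
  (\int[std_gaussian R d]_x (expR (t * (sq_norm x - d%:R)))%:E =
   (expR (- t * d%:R) * (Num.sqrt (1 - 2 * t))^-1 ^+ d)%:E)%E.
Proof.
move=> ht.
rewrite (eq_integral (fun x => (expR (- t * d%:R))%:E *
   (expR (- (- t) * shifted_sq_norm (fun=> 0) x))%:E)%E); last first.
  move=> x _; rewrite -EFinM -expRD; congr (expR _)%:E.
  rewrite /shifted_sq_norm; under eq_bigr do rewrite add0r.
  by rewrite -/(sq_norm x); ring.
rewrite ge0_integralZl//; last first.
  apply/measurable_EFinP; apply: measurableT_comp => //.
  apply: measurable_funM => //; exact: (measurable_shifted_sq_norm (fun=> 0)).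
rewrite (integral_std_gaussian_tilt (fun=> 0)); last by lra.
rewrite (_ : \sum_(i < d) 0 ^+ 2 = 0); last by rewrite big1// => i _; rewrite expr0n.
by rewrite mulr0 mul0r expR0 mulr1 mulrN -EFinM.
Qed.

Lemma mgf_sq_norm_ub d (t : R) : 0 <= t <= 4^-1 ->
  (\int[std_gaussian R d]_x (expR (t * (sq_norm x - d%:R)))%:E
   <= (expR (4 * t ^+ 2 * d%:R))%:E)%E.
Proof.
move=> ht; rewrite mgf_sq_norm ?lee_fin; last by lra.
apply: (@le_trans _ _ (expR (- t * d%:R) * expR (t + 4 * t ^+ 2) ^+ d)).
  rewrite ler_wpM2l ?expR_ge0// lerXn2r ?nnegrE ?invr_ge0 ?sqrtr_ge0 ?expR_ge0//.
  exact: invsqrt_sub_ub.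
rewrite -expRM_natr -expRD ler_expR le_eqVlt; apply/orP; left; apply/eqP; ring.
Qed.

Lemma mgf_sq_norm_lb d (t : R) : 0 <= t < 2^-1 ->
  ((expR (t ^+ 2 * d%:R / 2))%:E <=
   \int[std_gaussian R d]_x (expR (t * (sq_norm x - d%:R)))%:E)%E.
Proof.
move=> ht; rewrite mgf_sq_norm ?lee_fin; last by lra.
apply: (@le_trans _ _ (expR (- t * d%:R) * expR (t + t ^+ 2 / 2) ^+ d)).
  by rewrite -expRM_natr -expRD ler_expR le_eqVlt; apply/orP; left; apply/eqP; ring.
rewrite ler_wpM2l ?expR_ge0// lerXn2r ?nnegrE ?invr_ge0 ?sqrtr_ge0 ?expR_ge0//.
exact: invsqrt_sub_lb.
Qed.

(** The noncentrality enters through the exact factor exp (- t |m|^2 / (1 + 2t)), so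
    no separate control of the cross terms between m and the noise is needed. *)
Lemma lower_mgf_shifted_sq_norm d (t : R) (m : 'I_d -> R) : 0 <= t <= 2^-1 ->
  (\int[std_gaussian R d]_x (expR (- t * shifted_sq_norm m x))%:E
   <= (expR (- t * d%:R + 2 * t ^+ 2 * d%:R - t * (\sum_(i < d) m i ^+ 2) / 2))%:E)%E.
Proof.
move=> ht; have /andP[t0 t2] := ht.
rewrite integral_std_gaussian_tilt; last by lra.
rewrite lee_fin; set M := \sum_(i < d) _.
have M0 : 0 <= M by apply: sumr_ge0 => i _; exact: sqr_ge0.
apply: (@le_trans _ _ (expR (- t + 2 * t ^+ 2) ^+ d * expR (- t * M / 2))).
  apply: ler_pM; rewrite ?exprn_ge0 ?invr_ge0 ?sqrtr_ge0 ?expR_ge0//.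
    rewrite lerXn2r ?nnegrE ?invr_ge0 ?sqrtr_ge0 ?expR_ge0//.
    exact: invsqrt_add_ub.
  rewrite ler_expR !mulNr lerN2 ler_wpM2l ?mulr_ge0// lef_pV2 ?posrE; lra.
rewrite -expRM_natr -expRD ler_expR le_eqVlt; apply/orP; left; apply/eqP; ring.
Qed.

End gaussian_vector.

(** * Thresholded chi-square variables *)

(** For a centered x the linear term integrates to zero, which leaves an exponential
    moment of order 1 + E (x^2 exp |x|). *)
Lemma expR_le_quad (R : realType) (x : R) :
  expR x <= 1 + x + x ^+ 2 * expR `|x|.
Proof.
have h1 : expR x <= 1 + x * expR x.
  have := expR_ge1Dx (- x); rewrite expRN => h.
  have e0 := expR_gt0 x.
  have : (1 - x) * expR x <= 1.
    by rewrite -ler_pdivlMr// div1r.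
  by lra.
have [x0|x0] := lerP 0 x.
  have e0 := expR_ge0 x; rewrite ger0_norm//.
  have h2 : x * expR x <= x * (1 + x * expR x) by rewrite ler_wpM2l.
  by lra.
have e1 := expR_ge1Dx x.
have h2 : x * expR x <= x * (1 + x) by rewrite ler_wnM2l// ltW.
have h3 : x ^+ 2 * 1 <= x ^+ 2 * expR `|x|.
  by rewrite ler_wpM2l ?sqr_ge0// -expR0 ler_expR.
by lra.
Qed.


Lemma sqr_le_expR (R : realType) (t x : R) : 0 < t -> 0 <= x ->
  x ^+ 2 <= 2 / t ^+ 2 * expR (t * x).
Proof.
move=> t0 x0; have := @expR_ge1Dxn R (t * x) 1 (mulr_ge0 (ltW t0) x0).
rewrite (_ : 2`!%:R = 2 :> R)// exprMn => h.
have t20 : 0 < t ^+ 2 by rewrite exprn_gt0.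
rewrite [2 / _]mulrC -mulrA ler_pdivlMl//; lra.
Qed.

Definition trunc_excess (R : realType) (d : nat) (r z : R) : R :=
  (z - alpha r d) * (d%:R + r ^+ 2 <= z)%R%:R.

Lemma measurable_trunc_excess (R : realType) disp (T : measurableType disp)
    (d : nat) (r : R) (Z : T -> R) :
  measurable_fun setT Z -> measurable_fun setT (fun x => trunc_excess d r (Z x)).
Proof.
move=> mZ; apply: measurable_funM; first exact: measurable_funB.
have mb : measurable_fun setT (fun x => d%:R + r ^+ 2 <= Z x) by exact: measurable_fun_ler.
by apply: (measurableT_comp (f := fun b : bool => b%:R : R)).
Qed.

(** The centering [alpha r d] exceeds d by at most [alpha_const] times the scale of
    the threshold; 15 * 100^2 is the rate, in units of L, of the lower bound on the
    probability of exceedance. [mgf_const] bounds the logarithm of the exponential moment of all the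
    coordinates without signal. *)
Definition alpha_const (R : realType) : R := 15 * 100 ^+ 2 + 8.

Definition mgf_const (R : realType) : R :=
  2 * (1 + (alpha_const R / 49) ^+ 2) * expR (alpha_const R / 2).

Lemma alpha_const_gt0 (R : realType) : 0 < alpha_const R.
Proof. by rewrite /alpha_const; lra. Qed.

Lemma mgf_const_gt0 (R : realType) : 0 < mgf_const R.
Proof.
rewrite mulr_gt0 ?expR_gt0// mulr_gt0//.
by have := sqr_ge0 (alpha_const R / 49); lra.
Qed.

(** Writing delta = sqrt (L / d) makes L = delta^2 d and rho = sqrt (d L) = delta d
    polynomial in delta. The threshold lies 49 rho above the mean d, far enough for
    exceedance to be much rarer than exp (- L), and delta <= 1/800 keeps below 1/4
    every exponent at which the moments of a chi-square variable are taken. *)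
Section truncated_chi_square.
Variables (R : realType) (d : nat) (delta r : R).
Hypotheses (delta0 : 0 < delta) (delta_le : delta <= 800^-1).
Local Notation G := (std_gaussian R d).
Local Notation rho := (delta * d%:R).
Local Notation L := (delta ^+ 2 * d%:R).
Hypotheses (L2 : 2^-1 <= L) (r2 : r ^+ 2 = 49 * rho).
Local Notation E := [set x : d.-tuple (measurableTypeR R) | d%:R + r ^+ 2 <= sq_norm x].

Let L0 : 0 < L. Proof. by move: L2; lra. Qed.

Let rho0 : 0 < rho.
Proof. by rewrite -(pmulr_rgt0 _ delta0) mulrA -expr2. Qed.

Let delta_inv : delta^-1 <= 2 * rho.
Proof. 
rewrite -[leLHS]mulr1 ler_pdivrMl//.
by rewrite (_ : delta * (2 * rho) = 2 * L); [move: L2; lra|ring].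
Qed.

Let mE : measurable E.
Proof.
apply: (measurable_set_ler (f := cst (d%:R + r ^+ 2))) => //.
exact: measurable_sq_norm.
Qed.

Let m_exp t : measurable_fun setT
  (fun x : d.-tuple (measurableTypeR R) => (expR (t * (sq_norm x - d%:R)))%:E).
Proof.
apply/measurable_EFinP; apply: measurableT_comp => //.
by apply: measurable_funM => //; apply: measurable_funB => //; exact: measurable_sq_norm.
Qed.

(** Second moment method for the weight W = exp (t (|x|^2 - d)) with t = 100 delta.
    The mean of W is at least exp (100^2 L / 2), while W is at most exp (49 * 100 L) off
    the exceedance event; hence the event carries at least half of the mean, and the
    second moment of W turns this into a bound on its probability. *)
Lemma tail_lower_bound :
  ((expR (- (15 * 100 ^+ 2 * L)) / 2)%:E <= G E)%E.
Proof.
(* [a] is large enough for [ha], by which the mean of W dominates W off [E], and small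
   enough for the tilt 2 * [t] to stay below 1/4. *)
set a : R := 100.
have ha : 6 + 49 * a <= a ^+ 2 / 2 by rewrite /a; lra.
have a0 : 0 < a by rewrite /a.
pose t := a * delta; have t0 : 0 < t by rewrite mulr_gt0.
have t8 : t <= 8^-1 by rewrite /t /a; move: (delta_le); lra.
(* [b] is chosen so that b E W^2 is at most a quarter of the lower bound on E W. *)
set b := expR (- (31 / 2 * a ^+ 2 * L)) / 4.
have b0 : 0 < b by rewrite divr_gt0// expR_gt0.
pose W (x : d.-tuple (measurableTypeR R)) : R := expR (t * (sq_norm x - d%:R)).
pose W2 (x : d.-tuple (measurableTypeR R)) : R := expR (2 * t * (sq_norm x - d%:R)).
have ptw x : W x <= expR (49 * a * L) + b * W2 x + (4 * b)^-1 * \1_E x.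
  have e0 := expR_ge0 (49 * a * L).
  have -> : W2 x = W x ^+ 2 by rewrite -expRM_natl mulrA.
  rewrite indicE; case: (boolP (x \in E)) => xE.
    rewrite mulr1.
    have : 0 <= (2 * b * W x - 1) ^+ 2 / (4 * b).
      by rewrite divr_ge0 ?sqr_ge0// mulr_ge0 ?ltW.
    rewrite (_ : _ / _ = b * W x ^+ 2 - W x + (4 * b)^-1); last first.
      by field; rewrite gt_eqF.
    lra.
  rewrite mulr0 addr0 -[leLHS]addr0; apply: lerD; last first.
    by rewrite mulr_ge0 ?sqr_ge0 ?(ltW b0).
  move: xE; rewrite notin_setE/= => /negP; rewrite -ltNge r2 => xE.
  rewrite ler_expR (_ : 49 * a * L = t * (49 * rho)); last by rewrite /t; ring.
  by rewrite ler_wpM2l ?(ltW t0)//; lra.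
have h1 : ((expR (a ^+ 2 * L / 2))%:E <= \int[G]_x (W x)%:E)%E.
  rewrite (_ : a ^+ 2 * L = t ^+ 2 * d%:R); last by rewrite exprMn mulrA.
  by apply: mgf_sq_norm_lb; rewrite (ltW t0)/=; lra.
have h2 : (\int[G]_x (W2 x)%:E <= (expR (16 * a ^+ 2 * L))%:E)%E.
  rewrite (_ : 16 * a ^+ 2 * L = 4 * (2 * t) ^+ 2 * d%:R); last first.
    by rewrite /t; ring.
  by apply: mgf_sq_norm_ub; apply/andP; split; lra.
have h3 : (\int[G]_x (W x)%:E <=
    (expR (49 * a * L))%:E + b%:E * \int[G]_x (W2 x)%:E + (4 * b)^-1%:E * G E)%E.
  apply: (@le_trans _ _ (\int[G]_x ((expR (49 * a * L))%:E + b%:E * (W2 x)%:E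
     + (4 * b)^-1%:E * (\1_E x)%:E)%E)%E).
    apply: ge0_le_integral => //.
    - by move=> x _; rewrite lee_fin expR_ge0.
    - exact: m_exp.
    - apply: emeasurable_funD; last first.
        by apply: measurable_funeM; apply/measurable_EFinP; exact: measurable_indic.
      by apply: emeasurable_funD => //; apply: measurable_funeM; exact: m_exp.
    - by move=> x _; rewrite -!EFinM -!EFinD lee_fin; exact: ptw.
  have mW2 : measurable_fun setT (fun x => b%:E * (W2 x)%:E)%E.
    by apply: measurable_funeM; exact: m_exp.
  have mI : measurable_fun setT (fun x => (4 * b)^-1%:E * (\1_E x : R)%:E)%E.
    by apply: measurable_funeM; apply/measurable_EFinP; exact: measurable_indic.
  have b4 : 0 <= (4 * b)^-1 by rewrite invr_ge0 mulr_ge0// ltW.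
  have W20 x : (0 <= b%:E * (W2 x)%:E)%E.
    by rewrite -EFinM lee_fin mulr_ge0 ?expR_ge0// ltW.
  have I0 x : (0 <= (4 * b)^-1%:E * (\1_E x : R)%:E)%E.
    by rewrite -EFinM lee_fin mulr_ge0.
  rewrite ge0_integralD//; [|by move=> x _; rewrite adde_ge0// lee_fin expR_ge0
    |exact: emeasurable_funD].
  rewrite ge0_integralD//.
  rewrite integral_prob_cst ge0_integralZl//; [|exact: m_exp
    |by move=> x _; rewrite lee_fin expR_ge0|by rewrite lee_fin ltW].
  rewrite ge0_integralZl//; [|by apply/measurable_EFinP; exact: measurable_indic].
  by rewrite integral_indic// setIT.
have GE : G E = (fine (G E))%:E by rewrite fineK// fin_num_measure.
have {h1 h2 h3} : ((expR (a ^+ 2 * L / 2))%:E <= (expR (49 * a * L) +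
    b * expR (16 * a ^+ 2 * L) + (4 * b)^-1 * fine (G E))%:E)%E.
  rewrite !EFinD !EFinM -GE; apply: le_trans h1 _; apply: le_trans h3 _.
  by rewrite leeD2r// leeD2l// lee_wpmul2l// lee_fin ltW.
rewrite {2}GE !lee_fin; set g := fine _.
set X := expR (a ^+ 2 * L / 2).
have -> : b * expR (16 * a ^+ 2 * L) = X / 4.
  by rewrite mulrAC -expRD; congr (expR _ / _); lra.
have -> : (4 * b)^-1 = expR (15 * a ^+ 2 * L) * X.
  rewrite /b mulrCA divff// mulr1 -expRN opprK -expRD; congr expR; lra.
have X0 : 0 < X by exact: expR_gt0.
have h4 : expR (49 * a * L) <= X / 4.
  rewrite ler_pdivlMr// /X (_ : a ^+ 2 * L / 2 =
     49 * a * L + (a ^+ 2 / 2 - 49 * a) * L); last by lra.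
  rewrite expRD ler_wpM2l ?expR_ge0//.
  apply: le_trans (expR_ge1Dx _).
  have : 6 * 2^-1 <= (a ^+ 2 / 2 - 49 * a) * L by apply: ler_pM => //; lra.
  lra.
move=> h5.
have : X * 1 <= X * (2 * expR (15 * a ^+ 2 * L) * g) by lra.
rewrite ler_pM2l// expRN => h6.
have e0 := expR_gt0 (15 * a ^+ 2 * L).
rewrite ler_pdivrMr// -[leLHS]mulr1 ler_pdivrMl//; lra.
Qed.

Lemma integrable_mgf (t : R) : 0 <= t <= 4^-1 ->
  G.-integrable setT (EFin \o
    (fun x : d.-tuple (measurableTypeR R) => expR (t * (sq_norm x - d%:R)))).
Proof.
move=> ht; apply/integrableP; split; first exact: m_exp.
under eq_integral do rewrite /= ger0_norm ?expR_ge0//.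
by apply: le_lt_trans (mgf_sq_norm_ub _ ht) _; rewrite ltry.
Qed.

Let delta_itv : 0 <= delta <= 4^-1.
Proof. by rewrite (ltW delta0)/=; move: (delta_le); lra. Qed.

Lemma integrable_sq_norm : G.-integrable setT (EFin \o @sq_norm R d).
Proof.
have i1 := integrableD measurableT (integrableZl measurableT delta^-1
  (integrable_mgf delta_itv)) (finite_measure_integrable_cst G d%:R measurableT).
apply: le_integrable i1 => //; first by apply/measurable_EFinP; exact: measurable_sq_norm.
move=> x _ /=; rewrite lee_fin.
have z0 : 0 <= sq_norm x by apply: sumr_ge0 => i _; exact: sqr_ge0.
have e0 := expR_ge0 (delta * (sq_norm x - d%:R)).
rewrite !ger0_norm ?addr_ge0 ?mulr_ge0 ?invr_ge0 ?(ltW delta0)//.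
rewrite -lerBlDr ler_pdivlMl//.
by have := expR_ge1Dx (delta * (sq_norm x - d%:R)); lra.
Qed.

Let p := fine (G E).
Let GE : G E = p%:E. Proof. by rewrite fineK// fin_num_measure. Qed.

Let p_lb : expR (- (15 * 100 ^+ 2 * L)) / 2 <= p.
Proof. by rewrite -lee_fin -GE; exact: tail_lower_bound. Qed.

Let p0 : 0 < p.
Proof. by apply: lt_le_trans p_lb; rewrite divr_gt0// expR_gt0. Qed.

Let alphaE : alpha r d = (\int[G]_(x in E) sq_norm x) / p.
Proof. by []. Qed.

Let int_sq_norm : G.-integrable E (EFin \o @sq_norm R d).
Proof. exact: integrableS integrable_sq_norm. Qed.

Lemma alpha_lb : d%:R + r ^+ 2 <= alpha r d.
Proof.
rewrite alphaE ler_pdivlMr// -(@Rintegral_cst _ _ _ G E mE).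
apply: le_Rintegral => //; exact: finite_measure_integrable_cst.
Qed.

(** For every level c, the conditional mean of Z = |x|^2 - d is at most
    c + E exp (delta (Z - c)) / (delta P (exceedance)). Taking c a large multiple of rho,
    the factor exp (- delta c) absorbs the inverse of [tail_lower_bound]. *)
Lemma alpha_ub : alpha r d <= d%:R + alpha_const R * rho.
Proof.
rewrite /alpha_const; set c : R := 15 * 100 ^+ 2.
have c0 : 0 <= c by rewrite /c.
rewrite alphaE ler_pdivrMr//.
pose e (x : d.-tuple (measurableTypeR R)) := expR (delta * (sq_norm x - d%:R)).
set k := delta^-1 * expR (- ((c + 4) * L)).
have k0 : 0 <= k by rewrite mulr_ge0 ?expR_ge0// invr_ge0 ltW.
have ie : G.-integrable E (EFin \o e).
  by apply: integrableS (integrable_mgf delta_itv).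
have ike : G.-integrable E (EFin \o (fun x => k * e x)).
  exact: (integrableZl mE k ie).
have icst : G.-integrable E (EFin \o cst (d%:R + (c + 4) * rho)).
  exact: finite_measure_integrable_cst.
apply: (@le_trans _ _ (\int[G]_(x in E) (cst (d%:R + (c + 4) * rho) x + k * e x))).
  apply: le_Rintegral => //; first exact: (integrableD mE icst ike).
  move=> x _; rewrite /= /k -mulrA -expRD.
  rewrite (_ : - ((c + 4) * L) + _ = delta * (sq_norm x - d%:R - (c + 4) * rho)); last by ring.
  rewrite -lerBlDl ler_pdivlMl//.
  have := expR_ge1Dx (delta * (sq_norm x - d%:R - (c + 4) * rho)); lra.
rewrite RintegralD// Rintegral_cst// RintegralZl// -/p.
have h1 : \int[G]_(x in E) e x <= expR (4 * L).
  rewrite -lee_fin /Rintegral fineK; last first.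
    exact: integrable_fin_num ie.
  apply: (@le_trans _ _ (\int[G]_x (e x)%:E)%E).
    apply: ge0_subset_integral => //; first exact: m_exp.
    by move=> x _; rewrite lee_fin expR_ge0.
  by rewrite mulrA; exact: mgf_sq_norm_ub.
have h2 : k * \int[G]_(x in E) e x <= 2 * rho * (2 * p).
  apply: (@le_trans _ _ (k * expR (4 * L))); first by rewrite ler_wpM2l.
  rewrite /k -mulrA -expRD; apply: ler_pM; rewrite ?expR_ge0 ?invr_ge0 ?(ltW delta0)//.
  move: (p_lb); rewrite -/c ler_pdivrMr// [p * 2]mulrC; apply: le_trans.
  rewrite ler_expR; lra.
lra.
Qed.

Local Notation excess := (fun x : d.-tuple (measurableTypeR R) =>
  trunc_excess d r (sq_norm x)).

Let excessE : excess = (fun x => sq_norm x - alpha r d) \_ E.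
Proof.
apply/funext => x; rewrite patchE /trunc_excess; case: ifPn; rewrite !(inE, notin_setE)/=.
  by move=> ->; rewrite mulr1.
by move/negP/negbTE => ->; rewrite mulr0.
Qed.

Let int_sq_normB : G.-integrable E (EFin \o (fun x => sq_norm x - alpha r d)).
Proof.
exact: (integrableB mE int_sq_norm (finite_measure_integrable_cst G (alpha r d) mE)).
Qed.

Lemma integrable_excess : G.-integrable setT (EFin \o excess).
Proof.
have := int_sq_normB; rewrite integrable_mkcond//; apply: eq_integrable => // x _.
by rewrite excessE restrict_EFin.
Qed.

(** This is what the centering is for: [alpha r d] is the mean of the chi-square
    variable conditioned on exceedance. *)
Lemma integral_excess : \int[G]_x excess x = 0.
Proof.
rewrite excessE -Rintegral_mkcond RintegralB//; last first.
  exact: finite_measure_integrable_cst.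
by rewrite Rintegral_cst// -/p alphaE divfK ?subrr// gt_eqF.
Qed.

(** The linear term of [expR_le_quad] vanishes by [integral_excess]. The quadratic term
    lives on the exceedance event, where exp (delta (|x|^2 - d)) >= exp (49 L): this
    produces the factor exp (- L). *)
Lemma mgf_excess (l : R) : `|l| <= delta -> `|l| * rho <= 2^-1 ->
  (\int[G]_x (expR (l * excess x))%:E <=
   (expR (l ^+ 2 * (mgf_const R / delta ^+ 2 * expR (- L))))%:E)%E.
Proof.
move=> l1 l2.
have cb0 := alpha_const_gt0 R; set cb := alpha_const R in cb0 *.
have cm0 := mgf_const_gt0 R.
have d20 : 0 < delta ^+ 2 by rewrite exprn_gt0.
pose k := mgf_const R / delta ^+ 2 * expR (- (49 * L)).
have k0 : 0 <= k by rewrite mulr_ge0 ?expR_ge0// divr_ge0 ?ltW.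
pose e (x : d.-tuple (measurableTypeR R)) := expR (3 * delta * (sq_norm x - d%:R)).
have td : 0 <= 3 * delta <= 4^-1 by apply/andP; split; move: (delta_le) (delta0); lra.
have ptw x : expR (l * excess x) <= 1 + l * excess x + l ^+ 2 * (k * e x).
  apply: le_trans (expR_le_quad _) _; rewrite lerD2l exprMn -mulrA.
  rewrite ler_wpM2l ?sqr_ge0// /trunc_excess.
  case: (boolP (d%:R + r ^+ 2 <= sq_norm x)) => [Ex|_]; last first.
    by rewrite mulr0 expr0n mul0r mulr_ge0 ?expR_ge0.
  rewrite mulr1; have := alpha_ub; rewrite -/cb; have := alpha_lb; move: Ex.
  rewrite r2; set z := sq_norm x; set al := alpha r d => Ex al1 al2.
  have z0 : 0 <= z - d%:R by have := rho0; lra.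
  have b0 : 0 <= al - d%:R by have := rho0; lra.
  have h1 : (z - al) ^+ 2 <= (1 + (cb / 49) ^+ 2) * (z - d%:R) ^+ 2.
    have : (al - d%:R) ^+ 2 <= (cb / 49) ^+ 2 * (z - d%:R) ^+ 2.
      rewrite -exprMn ler_sqr ?nnegrE ?mulr_ge0 ?divr_ge0 ?(ltW cb0)//.
      apply: le_trans (_ : cb / 49 * (49 * rho) <= _); first lra.
      by rewrite ler_wpM2l ?divr_ge0 ?(ltW cb0)//; lra.
    have : 0 <= (z - d%:R) * (al - d%:R) by exact: mulr_ge0.
    by lra.
  have h2 : (z - d%:R) ^+ 2 <= 2 / delta ^+ 2 * expR (delta * (z - d%:R)).
    exact: sqr_le_expR.
  have h3 : expR `|l * (z - al)| <= expR (delta * (z - d%:R)) * expR (cb / 2).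
    rewrite -expRD ler_expR normrM.
    apply: (@le_trans _ _ (`|l| * ((z - d%:R) + (al - d%:R)))).
      rewrite ler_wpM2l// ler_norml; apply/andP; split; lra.
    rewrite mulrDr; apply: lerD; first by rewrite ler_wpM2r.
    apply: (@le_trans _ _ (`|l| * (cb * rho))); first by rewrite ler_wpM2l//; lra.
    by rewrite mulrCA ler_wpM2l ?(ltW cb0).
  apply: (@le_trans _ _ ((1 + (cb / 49) ^+ 2) * (2 / delta ^+ 2 * expR (delta * (z - d%:R)))
      * (expR (delta * (z - d%:R)) * expR (cb / 2)))).
    apply: ler_pM => //; rewrite ?sqr_ge0 ?expR_ge0//.
    apply: le_trans h1 _; rewrite ler_wpM2l//.
    by rewrite addr_ge0 ?sqr_ge0.
  rewrite (_ : _ * (_ * _) = mgf_const R / delta ^+ 2 *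
      (expR (delta * (z - d%:R)) * expR (delta * (z - d%:R)))); last first.
    by rewrite /mgf_const -/cb; ring.
  rewrite /k /e -[X in _ <= X]mulrA; apply: ler_wpM2l.
    by rewrite divr_ge0 ?(ltW cm0) ?(ltW d20).
  rewrite -!expRD ler_expR -/z.
  have : delta * (49 * rho) <= delta * (z - d%:R) by rewrite ler_wpM2l ?(ltW delta0)//; lra.
  lra.
have iX := integrable_excess.
have i1 : G.-integrable setT (EFin \o (fun x => 1 + l * excess x)).
  exact: (integrableD measurableT (finite_measure_integrable_cst G 1 measurableT)
    (integrableZl measurableT l iX)).
have i2 : G.-integrable setT (EFin \o (fun x => l ^+ 2 * (k * e x))).
  exact: (integrableZl measurableT (l ^+ 2) (integrableZl measurableT k (integrable_mgf td))).
apply: (@le_trans _ _ (\int[G]_x (1 + l * excess x + l ^+ 2 * (k * e x))%:E)%E).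
  apply: ge0_le_integral => //.
  - apply/measurable_EFinP; apply: measurableT_comp => //.
    apply: measurable_funM => //; apply: measurable_trunc_excess.
    exact: measurable_sq_norm.
  - by case/integrableP: (integrableD measurableT i1 i2).
  - by move=> x _; rewrite lee_fin; exact: ptw.
(* 36 = 4 * 3^2; the threshold supplies 49 >= 36 + 1. *)
have h1 : \int[G]_x (e x) <= expR (36 * L).
  rewrite -lee_fin /Rintegral fineK; last exact: integrable_fin_num (integrable_mgf td).
  by apply: le_trans (mgf_sq_norm_ub _ td) _; rewrite lee_fin ler_expR; lra.
have -> : (\int[G]_x (1 + l * excess x + l ^+ 2 * (k * e x))%:E =
    (1 + l ^+ 2 * (k * \int[G]_x (e x)))%:E)%E.
  rewrite -[LHS]fineK; last first.
    exact: integrable_fin_num (integrableD measurableT i1 i2).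
  congr EFin; rewrite -/(Rintegral _ _ _) RintegralD//.
  rewrite RintegralD//; last 2 first.
  - exact: finite_measure_integrable_cst.
  - exact: (integrableZl measurableT l iX).
  rewrite Rintegral_cst// RintegralZl// integral_excess mulr0 addr0.
  rewrite RintegralZl//; last exact: (integrableZl measurableT k (integrable_mgf td)).
  rewrite RintegralZl//; last exact: integrable_mgf.
  rewrite (_ : fine (G setT) = 1) ?mul1r//.
  by rewrite -[RHS]/(fine 1%E); congr fine; exact: probability_setT.
rewrite lee_fin; apply: le_trans (expR_ge1Dx _).
rewrite lerD2l ler_wpM2l ?sqr_ge0//.
apply: (@le_trans _ _ (k * expR (36 * L))); first by rewrite ler_wpM2l.
rewrite /k -mulrA -expRD; apply: ler_wpM2l.
  by rewrite divr_ge0 ?(ltW cm0) ?(ltW d20).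
by rewrite ler_expR; move: (L0); lra.
Qed.

(** Below the threshold z is also below [alpha r d], and zero is then the larger of the
    two sides. *)
Lemma trunc_excess_ge (z : R) : z - alpha r d <= trunc_excess d r z.
Proof.
rewrite /trunc_excess; case: (boolP (d%:R + r ^+ 2 <= z)) => h; first by rewrite mulr1.
by rewrite mulr0; have := alpha_lb; move: h; rewrite -ltNge; lra.
Qed.

(** By [trunc_excess_ge] the threshold disappears from a bound on the lower tail, and
    the remaining noncentral chi-square moment is explicit. *)
Lemma mgf_excess_shifted (l : R) (m : 'I_d -> R) : 0 <= l <= 2^-1 ->
  (\int[G]_x (expR (- l * trunc_excess d r (shifted_sq_norm m x)))%:E <=
   (expR (l * (alpha_const R * rho) + 2 * l ^+ 2 * d%:R
          - l * (\sum_(i < d) m i ^+ 2) / 2))%:E)%E.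
Proof.
move=> hl; have /andP[l0 _] := hl; set Z := shifted_sq_norm m.
have mZ : measurable_fun setT Z by exact: measurable_shifted_sq_norm.
apply: (@le_trans _ _ (\int[G]_x ((expR (l * alpha r d))%:E * (expR (- l * Z x))%:E))%E).
  apply: ge0_le_integral => //.
  - apply/measurable_EFinP; apply: measurableT_comp => //.
    by apply: measurable_funM => //; exact: measurable_trunc_excess.
  - apply: measurable_funeM; apply/measurable_EFinP; apply: measurableT_comp => //.
    exact: measurable_funM.
  - move=> x _; rewrite -EFinM lee_fin -expRD ler_expR.
    have : l * (Z x - alpha r d) <= l * trunc_excess d r (Z x).
      by rewrite ler_wpM2l// trunc_excess_ge.
    lra.
rewrite ge0_integralZl//; last first.
  apply/measurable_EFinP; apply: measurableT_comp => //; exact: measurable_funM.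
apply: (@le_trans _ _ ((expR (l * alpha r d))%:E * (expR (- l * d%:R + 2 * l ^+ 2 * d%:R
   - l * (\sum_(i < d) m i ^+ 2) / 2))%:E)%E).
  by rewrite lee_wpmul2l ?lee_fin ?expR_ge0//; exact: lower_mgf_shifted_sq_norm.
rewrite -EFinM lee_fin -expRD ler_expR.
have : l * alpha r d <= l * (d%:R + alpha_const R * rho) by rewrite ler_wpM2l ?alpha_ub.
lra.
Qed.

End truncated_chi_square.

(** * Tail bounds for the thresholded sum *)

Section exponential_bounds.
Variable R : realType.

Lemma exp_markov (d : measure_display) (T : measurableType d) (Q : probability T R)
    (X : T -> R) (t : R) : measurable_fun setT X ->
  (Q [set x | (t <= X x)%R] <= \int[Q]_x (expR (X x - t))%:E)%E.
Proof.
move=> mX.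
have mE : measurable [set x | t <= X x].
  exact: (measurable_set_ler (measurable_cst t)).
rewrite (_ : Q _ = \int[Q]_x (\1_[set x | t <= X x] x)%:E)%E; last first.
  by rewrite integral_indic// setIT.
apply: ge0_le_integral => //.
- by apply/measurable_EFinP; exact: measurable_indic.
- apply/measurable_EFinP; apply: measurableT_comp => //; exact: measurable_funB.
- move=> x _; rewrite lee_fin indicE; case: (boolP (x \in _)) => [|_]; last exact: expR_ge0.
  rewrite inE/= => tX; rewrite -[leLHS]expR0 ler_expR subr_ge0//.
Qed.

(** The blocks are independent, so exponential moments multiply. *)
Lemma std_gaussian_block_exp (p d : nat)
    (F : 'I_p -> d.-tuple (measurableTypeR R) -> R) (a : 'I_p -> R) :
  (forall j, measurable_fun setT (F j)) ->
  (forall j, (\int[std_gaussian R d]_x (expR (F j x))%:E <= (expR (a j))%:E)%E) ->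
  (\int[std_gaussian R (p * d)]_x
     (expR (\sum_(j < p) F j (pick_coords (block_ord j) x)))%:E <=
   (expR (\sum_(j < p) a j))%:E)%E.
Proof.
move=> mF Fa.
pose E j (y : d.-tuple (measurableTypeR R)) : \bar R := (expR (F j y))%:E.
rewrite (eq_integral (fun x => \prod_(j < p) E j (pick_coords (block_ord j) x))%E); last first.
  by move=> x _; rewrite prodEFin expR_sum.
rewrite integral_prod_block; last 2 first.
- by move=> j; apply/measurable_EFinP; exact: measurableT_comp.
- by move=> j x; rewrite lee_fin expR_ge0.
pose c j := fine (\int[std_gaussian R d]_x (expR (F j x))%:E)%E.
have c0 j : (0 <= \int[std_gaussian R d]_x (expR (F j x))%:E)%E.
  by apply: integral_ge0 => x _; rewrite lee_fin expR_ge0.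
have cE j : (\int[std_gaussian R d]_x E j x)%E = (c j)%:E.
  rewrite /c fineK// ge0_fin_numE//; apply: le_lt_trans (Fa j) _; exact: ltry.
under eq_bigr do rewrite cE.
rewrite prodEFin lee_fin expR_sum; apply: ler_prod => j _.
by rewrite -lee_fin -lee_fin -cE c0 Fa.
Qed.

(** The statistic as a function of the noise: [m j k] is the mean of the k-th
    standardized coefficient of coordinate j. *)
Definition trunc_stat (p d : nat) (r : R) (m : 'I_p -> 'I_d -> R)
    (x : (p * d).-tuple (measurableTypeR R)) : R :=
  \sum_(j < p) trunc_excess d r (shifted_sq_norm (m j) (pick_coords (block_ord j) x)).

Lemma measurable_trunc_stat p d r (m : 'I_p -> 'I_d -> R) :
  measurable_fun setT (trunc_stat r m).
Proof.
apply: measurable_sum => j; apply: measurable_trunc_excess.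
apply: (measurableT_comp (measurable_shifted_sq_norm _)).
exact: measurable_pick_coords.
Qed.

Section tails.
Variables (p d : nat) (delta r l : R).
Hypotheses (delta0 : 0 < delta) (delta_le : delta <= 800^-1).
Local Notation rho := (delta * d%:R).
Local Notation L := (delta ^+ 2 * d%:R).
Hypotheses (L2 : 2^-1 <= L) (r2 : r ^+ 2 = 49 * rho).
Hypotheses (l0 : 0 < l) (l_delta : l <= delta) (l_rho : l * rho <= 2^-1).
Local Notation V := (mgf_const R / delta ^+ 2 * expR (- L)).

(** The sign s is 1 for false alarms and -1 for missed detections. *)
Lemma mgf_null_block (s : R) : `|s| = 1 ->
  (\int[std_gaussian R d]_x
     (expR (s * l * trunc_excess d r (shifted_sq_norm (fun=> 0) x)))%:E <=
   (expR (l ^+ 2 * V))%:E)%E.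
Proof.
move=> s1.
have := @mgf_excess R d delta r delta0 delta_le L2 r2 (s * l).
rewrite normrM s1 mul1r (gtr0_norm l0) exprMn => /(_ l_delta l_rho).
rewrite -[s ^+ 2]real_normK ?num_real// s1 expr1n mul1r; apply: le_trans.
rewrite le_eqVlt; apply/orP; left; apply/eqP; apply: eq_integral => x _.
rewrite (_ : shifted_sq_norm _ _ = sq_norm x)//.
by apply: eq_bigr => i _; rewrite add0r.
Qed.

Lemma trunc_stat_null_tail (t : R) :
  (std_gaussian R (p * d) [set x | (t < trunc_stat r (fun (_ : 'I_p) (_ : 'I_d) => 0%R) x)%R] <=
   (expR (p%:R * (l ^+ 2 * V) - l * t))%:E)%E.
Proof.
set X := trunc_stat r _.
have mX : measurable_fun setT X by exact: measurable_trunc_stat.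
have mlX : measurable_fun setT (fun x => l * X x) by exact: measurable_funM.
apply: (@le_trans _ _ (std_gaussian R (p * d) [set x | (l * t <= l * X x)%R])).
  apply: le_measure; rewrite ?inE.
  - exact: (measurable_set_ltr (measurable_cst t)).
  - exact: (measurable_set_ler (measurable_cst (l * t))).
  - by move=> x /= tx; rewrite ler_wpM2l ?ltW.
apply: le_trans (exp_markov _ _ mlX) _.
pose F (j : 'I_p) (y : d.-tuple (measurableTypeR R)) :=
  1 * l * trunc_excess d r (shifted_sq_norm (fun=> 0) y).
rewrite (eq_integral (fun x => (expR (- (l * t)))%:E *
  (expR (\sum_(j < p) F j (pick_coords (block_ord j) x)))%:E)%E); last first.
  move=> x _; rewrite -EFinM -expRD; congr (expR _)%:E.
  by rewrite /F -mulr_sumr mul1r addrC.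
have mF (j : 'I_p) : measurable_fun setT (F j).
  by apply: measurable_funM => //; apply: measurable_trunc_excess;
    exact: measurable_shifted_sq_norm.
rewrite ge0_integralZl//; last first.
  apply/measurable_EFinP; apply: measurableT_comp => //.
  apply: measurable_sum => j; apply: (measurableT_comp (mF j)).
  exact: measurable_pick_coords.
apply: (@le_trans _ _ ((expR (- (l * t)))%:E *
    (expR (\sum_(j < p) (l ^+ 2 * V)))%:E)%E).
  apply: lee_wpmul2l; first by rewrite lee_fin expR_ge0.
  apply: std_gaussian_block_exp => // j.
  by apply: mgf_null_block; rewrite normr1.
by rewrite -EFinM -expRD sumr_const card_ord mulr_natl addrC.
Qed.

(** Coordinates outside S cost as much as under the null. A coordinate in S costs the
    excess of [alpha r d] over d and gains half of its signal energy. *)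
Lemma trunc_stat_signal_tail (S : {set 'I_p}) (m : 'I_p -> 'I_d -> R) (t : R) :
  (forall j k, j \notin S -> m j k = 0) ->
  (std_gaussian R (p * d) [set x | (trunc_stat r m x <= t)%R] <=
   (expR (l * t + #|S|%:R * (l * (alpha_const R * rho) + 2 * l ^+ 2 * d%:R)
     + p%:R * (l ^+ 2 * V) - l * (\sum_(j in S) \sum_(k < d) m j k ^+ 2) / 2))%:E)%E.
Proof.
move=> mS; set X := trunc_stat r m.
have mX : measurable_fun setT X by exact: measurable_trunc_stat.
have mlX : measurable_fun setT (fun x => - l * X x) by exact: measurable_funM.
have V0 : 0 <= l ^+ 2 * V.
  by rewrite mulr_ge0 ?sqr_ge0// mulr_ge0 ?expR_ge0// divr_ge0 ?sqr_ge0// ltW// mgf_const_gt0.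
have lhalf : 0 <= l <= 2^-1 by rewrite (ltW l0)/=; move: l_delta delta_le; lra.
apply: (@le_trans _ _ (std_gaussian R (p * d) [set x | (- l * t <= - l * X x)%R])).
  apply: le_measure; rewrite ?inE.
  - exact: (measurable_set_ler mX (measurable_cst t)).
  - exact: (measurable_set_ler (measurable_cst (- l * t))).
  - by move=> x /= tx; rewrite !mulNr lerN2 ler_wpM2l ?(ltW l0).
apply: le_trans (exp_markov _ _ mlX) _.
pose F (j : 'I_p) (y : d.-tuple (measurableTypeR R)) :=
  - l * trunc_excess d r (shifted_sq_norm (m j) y).
rewrite (eq_integral (fun x => (expR (l * t))%:E *
  (expR (\sum_(j < p) F j (pick_coords (block_ord j) x)))%:E)%E); last first.
  move=> x _; rewrite -EFinM -expRD; congr (expR _)%:E.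
  by rewrite /F -mulr_sumr addrC; congr (_ + _); ring.
have mF (j : 'I_p) : measurable_fun setT (F j).
  by apply: measurable_funM => //; apply: measurable_trunc_excess;
    exact: measurable_shifted_sq_norm.
rewrite ge0_integralZl//; last first.
  apply/measurable_EFinP; apply: measurableT_comp => //.
  apply: measurable_sum => j; apply: (measurableT_comp (mF j)).
  exact: measurable_pick_coords.
pose a (j : 'I_p) := (if j \in S then l * (alpha_const R * rho) + 2 * l ^+ 2 * d%:R
   - l * (\sum_(k < d) m j k ^+ 2) / 2 else 0) + l ^+ 2 * V.
apply: (@le_trans _ _ ((expR (l * t))%:E * (expR (\sum_(j < p) a j))%:E)%E).
  apply: lee_wpmul2l; first by rewrite lee_fin expR_ge0.
  apply: std_gaussian_block_exp => // j; rewrite /a; case: ifPn => jS.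
    apply: le_trans (mgf_excess_shifted delta0 delta_le L2 r2 (m j) lhalf) _.
    by rewrite lee_fin ler_expR lerDl.
  rewrite add0r /F.
  have := @mgf_null_block (-1); rewrite normrN1 mulN1r => /(_ erefl).
  by rewrite (_ : m j = fun=> 0)//; apply/funext => k; exact: mS.
rewrite -EFinM -expRD lee_fin ler_expR le_eqVlt; apply/orP; left; apply/eqP.
rewrite /a big_split/= -big_mkcond/= sumr_const card_ord.
rewrite sumrB sumr_const -[_ *+ #|S|]mulr_natl -[_ *+ p]mulr_natl.
rewrite -mulr_suml -mulr_sumr; ring.
Qed.

End tails.

End exponential_bounds.

(** * Square-integrable functions *)

Section L2_theory.
Context (R : realType) (d : measure_display) (T : measurableType d).
Variable m : {measure set T -> \bar R}.
Implicit Types (f g h : T -> R) (a : R).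
Local Notation sqi := (square_integrable m).
Local Notation "<< f , g >>" := (L2_inner m f g).

Lemma square_integrableP f : sqi f <->
  measurable_fun setT f /\ m.-integrable setT (EFin \o (fun x => f x ^+ 2)).
Proof.
split=> [h|[mf /integrableP[mf2 if2]]].
  split; last exact: Lfun2_integrable_sqr.
  by move: h; rewrite /square_integrable inE => /andP[/[!inE]].
rewrite /square_integrable inE; apply/andP; split; rewrite inE//=.
rewrite /finite_norm unlock; apply: poweR_lty.
apply: le_lt_trans if2; rewrite le_eqVlt; apply/orP; left; apply/eqP.
apply: eq_integral => x _ /=.
by rewrite normrX -powR_mulrn.
Qed.

Lemma square_integrable_mul f g : sqi f -> sqi g ->
  m.-integrable setT (EFin \o (fun x => f x * g x)).
Proof. by move=> sf sg; apply/Lfun1_integrable; exact: Lfun2_mul_Lfun1. Qed.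

Lemma square_integrable0 : sqi (fun=> 0).
Proof.
apply/square_integrableP; split => //.
rewrite [X in integrable _ _ X](_ : _ = cst 0%E); first exact: integrable0.
by apply/funext => x; rewrite /= expr0n.
Qed.

Lemma square_integrable_lin a f g : sqi f -> sqi g -> sqi (fun x => a * f x + g x).
Proof.
move=> /square_integrableP[mf if2] /square_integrableP[mg ig2].
have mfg : measurable_fun setT (fun x => a * f x + g x).
  by apply: measurable_funD => //; exact: measurable_funM.
apply/square_integrableP; split => //.
have i1 := integrableD measurableT (integrableZl measurableT (2 * a ^+ 2) if2)
  (integrableZl measurableT 2 ig2).
apply: le_integrable i1 => //.
  by apply/measurable_EFinP; exact: measurable_funX.
move=> x _ /=; rewrite lee_fin ger0_norm ?sqr_ge0// ger0_norm; last first.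
  by rewrite addr_ge0// mulr_ge0 ?sqr_ge0// mulr_ge0 ?sqr_ge0.
have : 0 <= (a * f x - g x) ^+ 2 by exact: sqr_ge0.
by lra.
Qed.

Lemma square_integrable_scale a f : sqi f -> sqi (fun x => a * f x).
Proof.
move=> sf; have := square_integrable_lin a sf square_integrable0.
by under eq_fun do rewrite addr0.
Qed.

Lemma square_integrableB f g : sqi f -> sqi g -> sqi (fun x => f x - g x).
Proof.
move=> sf sg; have := square_integrable_lin (-1) sg sf.
by under eq_fun do rewrite mulN1r addrC.
Qed.

Lemma square_integrable_sum (I : Type) (s : seq I) (P : pred I) (F : I -> T -> R) :
  (forall i, P i -> sqi (F i)) -> sqi (fun x => \sum_(i <- s | P i) F i x).
Proof.
move=> sF; elim: s => [|i s IH].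
  under eq_fun do rewrite big_nil.
  exact: square_integrable0.
have [Pi|Pi] := boolP (P i); last first.
  by under eq_fun do rewrite big_cons (negbTE Pi).
under eq_fun do rewrite big_cons Pi.
have := square_integrable_lin 1 (sF _ Pi) IH.
by under eq_fun do rewrite mul1r.
Qed.

Lemma L2_innerC f g : <<f, g>> = <<g, f>>.
Proof. by apply: eq_Rintegral => x _; rewrite mulrC. Qed.

Lemma L2_inner0l g : <<(fun=> 0), g>> = 0.
Proof.
rewrite /L2_inner /Rintegral.
by rewrite (eq_integral (cst 0%E)) ?integral0// => x _; rewrite mul0r.
Qed.

Lemma L2_inner_linl a f g h : sqi f -> sqi g -> sqi h ->
  << (fun x => a * f x + g x), h >> = a * <<f, h>> + <<g, h>>.
Proof.
move=> sf sg sh.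
have ifh := square_integrable_mul sf sh; have igh := square_integrable_mul sg sh.
rewrite /L2_inner -RintegralZl//.
rewrite -RintegralD//; last exact: (integrableZl measurableT a ifh).
by apply: eq_Rintegral => x _; rewrite mulrDl mulrA.
Qed.

Lemma L2_innerBl f g h : sqi f -> sqi g -> sqi h ->
  << (fun x => f x - g x), h >> = <<f, h>> - <<g, h>>.
Proof.
move=> sf sg sh; have := L2_inner_linl (-1) sg sf sh.
under [X in L2_inner _ X _ = _ -> _]eq_fun do rewrite mulN1r addrC.
by move=> ->; rewrite mulN1r addrC.
Qed.

Lemma L2_innerB_sqr f g : sqi f -> sqi g ->
  << (fun x => f x - g x), (fun x => f x - g x) >> =
  <<f, f>> - 2 * <<g, f>> + <<g, g>>.
Proof.
move=> sf sg; have sB := square_integrableB sf sg.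
rewrite L2_innerBl// L2_innerC L2_innerBl// [X in _ - X]L2_innerC L2_innerBl//.
by rewrite (L2_innerC f g); ring.
Qed.

Lemma L2_inner_scalel a f h : sqi f -> sqi h ->
  << (fun x => a * f x), h >> = a * <<f, h>>.
Proof.
move=> sf sh; have := L2_inner_linl a sf square_integrable0 sh.
under [X in L2_inner _ X _ = _ -> _]eq_fun do rewrite addr0.
by move=> ->; rewrite L2_inner0l addr0.
Qed.

Lemma L2_inner_suml (I : Type) (s : seq I) (P : pred I) (F : I -> T -> R) h :
  (forall i, P i -> sqi (F i)) -> sqi h ->
  << (fun x => \sum_(i <- s | P i) F i x), h >> = \sum_(i <- s | P i) <<F i, h>>.
Proof.
move=> sF sh; elim: s => [|i s IH].
  under [X in L2_inner _ X _]eq_fun do rewrite big_nil.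
  by rewrite L2_inner0l big_nil.
rewrite big_cons -IH; have [Pi|Pi] := boolP (P i); last first.
  by under [X in L2_inner _ X _ = _]eq_fun do rewrite big_cons (negbTE Pi).
under [X in L2_inner _ X _ = _]eq_fun do rewrite big_cons Pi -[F i _]mul1r.
rewrite L2_inner_linl ?mul1r//; first exact: sF.
exact: square_integrable_sum.
Qed.

Lemma L2_norm_sqr_ge a f : sqi f -> 0 <= a -> (a%:E <= L2_norm m f)%E ->
  a ^+ 2 <= <<f, f>>.
Proof.
move=> sf a0 h.
have : ((a `^ 2)%:E <= L2_norm m f `^ 2)%E.
  rewrite -poweR_EFin gt0_ler_poweR// in_itv/= leey andbT ?lee_fin//.
  exact: Lnorm_ge0.
rewrite powR_mulrn// /L2_norm powR_Lnorm// => h2.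
rewrite -lee_fin; apply: le_trans h2 _.
rewrite /L2_inner /Rintegral fineK; last first.
  exact: integrable_fin_num (square_integrable_mul sf sf).
rewrite le_eqVlt; apply/orP; left; apply/eqP; apply: eq_integral => x _ /=.
by rewrite powR_mulrn// -normrX ger0_norm ?sqr_ge0.
Qed.

Lemma L2_inner_sqrD_le a f g : sqi f -> sqi g -> 0 < a ->
  << (fun x => f x + g x), (fun x => f x + g x) >> <=
  (1 + a) * <<f, f>> + (1 + a^-1) * <<g, g>>.
Proof.
move=> sf sg a0.
have a1 : a != 0 by rewrite gt_eqF.
have sff := square_integrable_mul sf sf; have sgg := square_integrable_mul sg sg.
rewrite /L2_inner -2?RintegralZl//.
have i1 := integrableZl measurableT (1 + a) sff.
have i2 := integrableZl measurableT (1 + a^-1) sgg.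
rewrite -RintegralD//; apply: le_Rintegral => //.
- have sfg : sqi (fun x => f x + g x).
    by have := square_integrable_lin 1 sf sg; under eq_fun do rewrite mul1r.
  exact: square_integrable_mul.
- exact: integrableD i1 i2.
- move=> x _; rewrite -!expr2.
  have : 0 <= (a * f x - g x) ^+ 2 / a by rewrite divr_ge0 ?sqr_ge0// ltW.
  rewrite (_ : (a * f x - g x) ^+ 2 / a =
    a * f x ^+ 2 - 2 * f x * g x + a^-1 * g x ^+ 2); last by field.
  by lra.
Qed.

Section orthonormal_family.
Variables (psi : nat -> T -> R) (psiO : Defs.orthonormal m psi).

Lemma L2_inner_combl (N : nat) (c : nat -> R) h : sqi h ->
  << (fun x => \sum_(0 <= k < N) c k * psi k x), h >> =
  \sum_(0 <= k < N) c k * <<psi k, h>>.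
Proof.
move=> sh; have [spsi _] := psiO.
rewrite L2_inner_suml//; last by move=> k _; exact: square_integrable_scale.
by apply: eq_bigr => k _; rewrite L2_inner_scalel.
Qed.

Lemma square_integrable_comb (d0 N : nat) (c : nat -> R) :
  sqi (fun x => \sum_(d0 <= k < N) c k * psi k x).
Proof.
have [spsi _] := psiO.
by apply: square_integrable_sum => k _; exact: square_integrable_scale.
Qed.

Lemma L2_inner_comb_sqr (d0 N : nat) (c : nat -> R) :
  << (fun x => \sum_(d0 <= k < N) c k * psi k x),
     (fun x => \sum_(d0 <= k < N) c k * psi k x) >> =
  \sum_(d0 <= k < N) c k ^+ 2.
Proof.
have [spsi opsi] := psiO; have scomb := square_integrable_comb d0 N c.
rewrite {1}/L2_inner -/(L2_inner m _ _) L2_inner_suml//; last first.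
  by move=> k _; exact: square_integrable_scale.
rewrite big_nat [RHS]big_nat; apply: eq_bigr => k hk.
rewrite L2_inner_scalel// L2_innerC L2_inner_suml//; last first.
  by move=> j _; exact: square_integrable_scale.
rewrite (bigD1_seq k)/= ?mem_index_iota ?iota_uniq//.
rewrite L2_inner_scalel// opsi eqxx mulr1 big1 ?addr0 ?expr2//.
by move=> j /negbTE jk; rewrite L2_inner_scalel// opsi jk mulr0.
Qed.

(** The Fourier coefficients give the best approximation in the span. *)
Lemma bessel_defect_le (N : nat) (c : nat -> R) f : sqi f ->
  <<f, f>> - \sum_(0 <= k < N) <<psi k, f>> ^+ 2 <=
  << (fun x => f x - \sum_(0 <= k < N) c k * psi k x),
     (fun x => f x - \sum_(0 <= k < N) c k * psi k x) >>.
Proof.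
move=> sf; have scomb := square_integrable_comb 0 N c.
rewrite L2_innerB_sqr// L2_inner_comb_sqr L2_inner_combl//.
have : 0 <= \sum_(0 <= k < N) (<<psi k, f>> - c k) ^+ 2.
  by apply: sumr_ge0 => k _; exact: sqr_ge0.
have -> : \sum_(0 <= k < N) (<<psi k, f>> - c k) ^+ 2 =
    \sum_(0 <= k < N) <<psi k, f>> ^+ 2 - 2 * \sum_(0 <= k < N) c k * <<psi k, f>>
    + \sum_(0 <= k < N) c k ^+ 2.
  rewrite mulr_sumr -sumrB -big_split/=; apply: eq_bigr => k _; ring.
by lra.
Qed.

End orthonormal_family.

End L2_theory.

(** * Functions of one coordinate under a product measure *)

Section coordinates.
Context (R : realType) (d : measure_display) (T : measurableType d).

Definition coord n (i : 'I_n) (x : n.-tuple T) : T := tnth x i.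

HB.instance Definition _ n (i : 'I_n) :=
  @isMeasurableFun.Build _ _ _ _ (coord i) (measurable_tnth i).

Definition coord_pair n (i j : 'I_n) (x : n.-tuple T) : T * T := (tnth x i, tnth x j).

Lemma measurable_coord_pair n (i j : 'I_n) : measurable_fun setT (coord_pair i j).
Proof. by apply: measurable_fun_pair; exact: measurable_tnth. Qed.

HB.instance Definition _ n (i j : 'I_n) :=
  @isMeasurableFun.Build _ _ _ _ (coord_pair i j) (measurable_coord_pair i j).

Variables (P : probability T R) (n : nat).
Local Notation Q := (product_prob P n).

Lemma ge0_integral_coord (i : 'I_n) (f : T -> \bar R) :
  measurable_fun setT f -> (forall x, 0 <= f x)%E ->
  (\int[Q]_x f (tnth x i) = \int[P]_x f x)%E.
Proof.
move=> mf f0; rewrite -[LHS]/(\int[Q]_x (f \o coord i) x)%E.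
rewrite -ge0_integral_distribution//.
apply: eq_measure_integral => A mA _; exact: product_prob_tnth.
Qed.

Lemma integrable_coord (i : 'I_n) (f : T -> \bar R) :
  P.-integrable setT f -> Q.-integrable setT (fun x => f (tnth x i)).
Proof.
move=> /integrableP[mf fi]; apply/integrableP; split.
  by apply: (measurableT_comp mf); exact: measurable_tnth.
by rewrite (@ge0_integral_coord i (fun x => `|f x|%E))//; exact: measurableT_comp.
Qed.

Lemma Rintegral_coord (i : 'I_n) (f : T -> R) :
  P.-integrable setT (EFin \o f) ->
  \int[Q]_x f (tnth x i) = \int[P]_x f x.
Proof.
move=> fi; congr fine.
rewrite -[LHS]/(\int[Q]_x ((EFin \o f) \o coord i) x)%E.
rewrite -integral_distribution//; last 2 first.
- by case/integrableP: fi.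
- exact: integrable_coord.
apply: eq_measure_integral => A mA _; exact: product_prob_tnth.
Qed.

Lemma square_integrable_coord (i : 'I_n) (f : T -> R) :
  square_integrable P f -> square_integrable Q (fun x => f (tnth x i)).
Proof.
move=> /square_integrableP[mh ih]; apply/square_integrableP; split.
  by apply: (measurableT_comp mh); exact: measurable_tnth.
exact: (integrable_coord i ih).
Qed.

Lemma Rintegral_coord_pair (i j : 'I_n) (f g : T -> R) : i != j ->
  square_integrable P f -> square_integrable P g ->
  \int[Q]_x (f (tnth x i) * g (tnth x j)) = \int[P]_x f x * \int[P]_x g x.
Proof.
move=> ij sf sg.
have [mf _] := (square_integrableP _ _).1 sf.
have [mg _] := (square_integrableP _ _).1 sg.
have if1 : P.-integrable setT (EFin \o f).
  apply/Lfun1_integrable; apply: (Lfun_subset12 _ sf).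
  by rewrite fin_num_measure.
have ig1 : P.-integrable setT (EFin \o g).
  apply/Lfun1_integrable; apply: (Lfun_subset12 _ sg).
  by rewrite fin_num_measure.
pose F (y : T * T) := (f y.1 * g y.2)%:E.
have mF : measurable_fun setT F.
  apply/measurable_EFinP; apply: measurable_funM.
    exact: (measurableT_comp mf).
  exact: (measurableT_comp mg).
have iFQ : Q.-integrable setT (F \o coord_pair i j).
  exact: (square_integrable_mul (square_integrable_coord i sf)
    (square_integrable_coord j sg)).
have PQ A : measurable A -> (P \x P)%E A = distribution Q (coord_pair i j) A.
  apply: product_measure_unique => B C mB mC.
  by have := @product_prob_rectangle _ _ _ P n i j B C ij mB mC.
have iF : (P \x P)%E.-integrable setT F.
  apply/integrableP; split => //; case/integrableP: iFQ => _.
  apply: le_lt_trans; rewrite le_eqVlt; apply/orP; left; apply/eqP.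
  transitivity (\int[distribution Q (coord_pair i j)]_y `|F y|)%E.
    by apply: eq_measure_integral => A mA _; exact: PQ.
  by rewrite ge0_integral_distribution//; exact: measurableT_comp.
rewrite -[LHS]/(fine (\int[Q]_x (F \o coord_pair i j) x)%E).
rewrite -integral_distribution//.
rewrite (@eq_measure_integral _ _ _ _ (P \x P)%E); last first.
  by move=> A mA _; apply/esym; exact: PQ.
rewrite -integral12_prod_meas1//.
rewrite (eq_integral (fun x => (\int[P]_y g y)%:E * (f x)%:E)%E); last first.
  move=> x _; rewrite /fubini_F /F /=.
  under eq_integral do rewrite EFinM.
  rewrite integralZl// muleC; congr (_ * _)%E.
  by rewrite /Rintegral fineK//; exact: integrable_fin_num.
by rewrite integralZl// fineM ?fineK ?integrable_fin_num//= mulrC.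
Qed.

Lemma L2_inner_coord (i j : 'I_n) (f g : T -> R) :
  square_integrable P f -> square_integrable P g -> \int[P]_x g x = 0 ->
  L2_inner Q (fun x => f (tnth x i)) (fun x => g (tnth x j)) =
  if i == j then L2_inner P f g else 0.
Proof.
move=> sf sg g0; case: eqVneq => [<-|ij]; last first.
  by rewrite /L2_inner Rintegral_coord_pair// g0 mulr0.
by rewrite /L2_inner (Rintegral_coord i (square_integrable_mul sf sg)).
Qed.

End coordinates.

(** * Approximation in a reproducing kernel Hilbert space *)

(** Convergence is only required on the unit interval, which carries the measure. *)
Lemma L2_fatou (R : realType) (u : nat -> R -> R) (v : R -> R) (C : R) :
  (forall n, square_integrable (lebesgue01 R) (u n)) ->
  square_integrable (lebesgue01 R) v ->
  (forall x, 0 <= x <= 1 -> u n x @[n --> \oo] --> v x) ->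
  (forall n, L2_inner (lebesgue01 R) (u n) (u n) <= C) ->
  L2_inner (lebesgue01 R) v v <= C.
Proof.
move=> su sv uv uC.
have normE (w : R -> R) : square_integrable (lebesgue01 R) w ->
    ((L2_inner (lebesgue01 R) w w)%:E =
     \int[lebesgue_measure]_(x in `[0%R, 1%R]) (w x ^+ 2)%:E)%E.
  move=> sw; rewrite /L2_inner /Rintegral fineK; last first.
    exact: integrable_fin_num (square_integrable_mul sw sw).
  rewrite integral_uniform.
  - rewrite subr0 invr1 mul1e; apply: eq_integral => x _.
    by rewrite expr2.
  - by case/integrableP: (square_integrable_mul sw sw).
  - by move=> x; rewrite lee_fin -expr2 sqr_ge0.
have mu2 (w : R -> R) : square_integrable (lebesgue01 R) w ->
    measurable_fun (`[0%R, 1%R]%classic : set (measurableTypeR R)) (fun x => (w x ^+ 2)%:E).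
  move=> /square_integrableP[mw _]; apply/measurable_EFinP; apply: measurable_funX.
  exact: measurable_funTS.
rewrite -lee_fin normE//.
rewrite (eq_integral (fun x : measurableTypeR R => limn_einf (fun n => (u n x ^+ 2)%:E))); last first.
  move=> x; rewrite inE/= in_itv/= => x01; apply/esym.
  have h : (u n x ^+ 2)%:E @[n --> \oo] --> (v x ^+ 2)%:E.
    apply/cvg_EFin; first exact: nearW.
    exact: (cvg_comp _ _ (uv x x01) (@sqr_continuous R (v x))).
  by have [-> _] := cvg_limn_einf_sup h.
apply: le_trans (fatou _ _ _ _) _ => //.
- by move=> n; exact: mu2.
- by move=> n x _; rewrite lee_fin sqr_ge0.
rewrite limn_einf_lim; apply: lime_le; first exact: is_cvg_einfs.
apply: nearW => n; apply: (@le_trans _ _ (L2_inner (lebesgue01 R) (u n) (u n))%:E).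
  by apply: ereal_inf_lbound; exists n => //=; rewrite normE.
by rewrite lee_fin.
Qed.

Lemma discriminant_le (R : realType) (e v w : R) : 0 <= w ->
  (forall t, 0 <= e - 2 * t * v + t ^+ 2 * w) -> v ^+ 2 <= e * w.
Proof.
rewrite le_eqVlt => /predU1P[<-|w0] h.
  rewrite mulr0; have [->|v0] := eqVneq v 0; first by rewrite expr0n.
  have := h ((e + 1) / (2 * v)); rewrite mulr0 addr0.
  rewrite (_ : 2 * _ * v = e + 1); first lra.
  by field.
have := h (v / w); rewrite -ler_pdivrMr//.
rewrite (_ : _ + _ = e - v ^+ 2 / w); first lra.
by field; rewrite gt_eqF.
Qed.

Section rkhs_theory.
Variables (R : realType) (H : set (R -> R)) (ip : (R -> R) -> (R -> R) -> R).
Variable K : R -> R -> R.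
Hypothesis rk : is_RKHS H ip K.
Implicit Types (f g h : R -> R) (a t : R).

Lemma rkhsB t f h : H f -> H h -> H (fun x => f x - t * h x).
Proof.
move=> Hf Hh; have := rkhs_lin rk (- t) Hh Hf.
by under eq_fun do rewrite mulNr addrC.
Qed.

Lemma rkhs_ip_linr a f g h : H f -> H g -> H h ->
  ip h (fun x => a * f x + g x) = a * ip h f + ip h g.
Proof.
move=> Hf Hg Hh; have Hfg := rkhs_lin rk a Hf Hg.
by rewrite (rkhs_ip_sym rk)// (rkhs_ip_lin rk)// !(rkhs_ip_sym rk _ Hh).
Qed.

Lemma rkhs_ip0r f : H f -> ip f (fun=> 0) = 0.
Proof.
move=> Hf; have H0 := rkhs_zero rk; have := rkhs_ip_linr 1 H0 H0 Hf.
under [X in ip _ X = _ -> _]eq_fun do rewrite mulr0 addr0.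
lra.
Qed.

Lemma rkhs_ip_sqrB t f h : H f -> H h ->
  ip (fun x => f x - t * h x) (fun x => f x - t * h x) =
  ip f f - 2 * t * ip f h + t ^+ 2 * ip h h.
Proof.
move=> Hf Hh; have HB := rkhsB t Hf Hh.
have E : (fun x => f x - t * h x) = (fun x => - t * h x + f x).
  by apply/funext => x; rewrite mulNr addrC.
rewrite {1}E (rkhs_ip_lin rk)// E !rkhs_ip_linr// (rkhs_ip_sym rk Hh Hf); ring.
Qed.

Lemma rkhs_cauchy_schwarz f h : H f -> H h -> ip f h ^+ 2 <= ip f f * ip h h.
Proof.
move=> Hf Hh; apply: discriminant_le; first exact: (rkhs_ip_ge0 rk).
by move=> t; rewrite -rkhs_ip_sqrB//; apply: (rkhs_ip_ge0 rk); exact: rkhsB.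
Qed.

(** Finite combinations of kernel sections, as lists of pairs (weight, point): for them
    both the norm of H and the Mercer expansion are explicit. *)
Definition point_comb (l : seq (R * R)) : R -> R :=
  fun y => \sum_(q <- l) q.1 * K y q.2.

Definition points01 (l : seq (R * R)) : bool := all (fun q => 0 <= q.2 <= 1) l.

Lemma point_comb_cons q l :
  point_comb (q :: l) = (fun y => q.1 * K y q.2 + point_comb l y).
Proof. by apply/funext => y; rewrite /point_comb big_cons. Qed.

Lemma rkhs_point_comb l : points01 l -> H (point_comb l).
Proof.
elim: l => [|q l IH] /=.
  move=> _; rewrite (_ : point_comb [::] = fun=> 0); first exact: (rkhs_zero rk).
  by apply/funext => y; rewrite /point_comb big_nil.
move=> /andP[q01 /IH Hl]; rewrite point_comb_cons.
by apply: (rkhs_lin rk) => //; exact: (rkhs_kernel rk).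
Qed.

Lemma ip_point_comb f l : H f -> points01 l ->
  ip f (point_comb l) = \sum_(q <- l) q.1 * f q.2.
Proof.
move=> Hf; elim: l => [|q l IH] /=.
  move=> _; rewrite (_ : point_comb [::] = fun=> 0); first by rewrite big_nil rkhs_ip0r.
  by apply/funext => y; rewrite /point_comb big_nil.
move=> /andP[q01 hl]; rewrite point_comb_cons big_cons -IH//.
rewrite (rkhs_ip_linr q.1 (rkhs_kernel rk q01) (rkhs_point_comb hl) Hf).
by rewrite -(rkhs_reproducing rk Hf q01).
Qed.

Definition point_comb_add (l1 : seq (R * R)) t (l2 : seq (R * R)) :=
  l1 ++ [seq (t * q.1, q.2) | q <- l2].

Lemma points01_add l1 t l2 : points01 l1 -> points01 l2 ->
  points01 (point_comb_add l1 t l2).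
Proof. by move=> h1 h2; rewrite /points01 all_cat all_map; apply/andP; split. Qed.

Lemma point_comb_addE l1 t l2 :
  point_comb (point_comb_add l1 t l2) = (fun y => point_comb l1 y + t * point_comb l2 y).
Proof.
apply/funext => y; rewrite /point_comb big_cat big_map/= mulr_sumr; congr (_ + _).
by apply: eq_bigr => q _; rewrite mulrA.
Qed.

Section near_minimizer.
Variables (g : R -> R) (Hg : H g).

(** The factor 1 gives the argument the shape expected by [rkhs_ip_sqrB]. *)
Definition comb_dist (l : seq (R * R)) : R :=
  ip (fun x => g x - 1 * point_comb l x) (fun x => g x - 1 * point_comb l x).

Definition min_dist : R := inf [set comb_dist l | l in [set l | points01 l]].

Let has_inf_dist : has_inf [set comb_dist l | l in [set l | points01 l]].
Proof.
split; first by exists (comb_dist [::]), [::].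
exists 0 => _ [l /= hl <-]; apply: (rkhs_ip_ge0 rk); apply: rkhsB => //.
exact: rkhs_point_comb.
Qed.

Lemma near_minimizer_exists (e : R) : 0 < e ->
  exists2 l, points01 l & comb_dist l <= min_dist + e.
Proof.
move=> e0; have [_ [l hl <-] h] := inf_adherent e0 has_inf_dist.
by exists l => //; exact: ltW.
Qed.

(** A quantitative form of the orthogonality of the residual of a projection: moving by
    a multiple t of another combination gains at most e for every t, and the
    discriminant of this quadratic polynomial in t is therefore nonpositive. *)
Lemma near_minimizer_orth (e : R) l l' : points01 l -> points01 l' ->
  comb_dist l <= min_dist + e ->
  ip (fun x => g x - 1 * point_comb l x) (point_comb l') ^+ 2 <=
  e * ip (point_comb l') (point_comb l').
Proof.
move=> hl hl' hd.
have Hl := rkhs_point_comb hl; have Hl' := rkhs_point_comb hl'.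
have HB := rkhsB 1 Hg Hl.
apply: discriminant_le; first exact: (rkhs_ip_ge0 rk).
move=> t.
have : min_dist <= comb_dist (point_comb_add l t l').
  apply: inf_lbound; first by case: has_inf_dist.
  by exists (point_comb_add l t l') => //=; exact: points01_add.
rewrite /comb_dist point_comb_addE.
rewrite [X in ip X X](_ : _ = (fun x => g x - 1 * point_comb l x - t * point_comb l' x)).
  by rewrite rkhs_ip_sqrB// -/(comb_dist l); lra.
by apply/funext => x; ring.
Qed.

End near_minimizer.

End rkhs_theory.

(** * Spectral tail of the unit ball *)

Section mercer_tail.
Variables (R : realType) (H : set (R -> R)) (ip : (R -> R) -> (R -> R) -> R).
Variables (K : R -> R -> R) (mu : nat -> R) (psi : nat -> R -> R).
Hypotheses (rk : is_RKHS H ip K) (me : mercer_expansion K mu psi).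
Local Notation U := (lebesgue01 R).
Local Notation comb := (point_comb K).

Definition mercer_coef (l : seq (R * R)) (k : nat) : R :=
  \sum_(q <- l) q.1 * psi k q.2.

Lemma point_comb_mercer l y : points01 l -> 0 <= y <= 1 ->
  (\sum_(0 <= k < N) mu k * mercer_coef l k * psi k y) @[N --> \oo] --> comb l y.
Proof.
move=> hl y01; elim: l hl => [|q l IH] /=.
  move=> _; rewrite (_ : (fun N => _) = fun=> 0).
    by rewrite /point_comb big_nil; exact: cvg_cst.
  apply/funext => N; rewrite big1// => k _.
  by rewrite /mercer_coef big_nil mulr0 mul0r.
move=> /andP[q01 hl]; rewrite point_comb_cons.
rewrite (_ : (fun N => _) = (fun N => q.1 * \sum_(0 <= k < N) mu k * psi k y * psi k q.2
   + \sum_(0 <= k < N) mu k * mercer_coef l k * psi k y)).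
  apply: cvgD; last exact: IH.
  by apply: cvgMr; exact: (mercer_sum me).
apply/funext => N; rewrite mulr_sumr -big_split/=; apply: eq_bigr => k _.
by rewrite /mercer_coef big_cons; ring.
Qed.

Lemma ip_point_comb_mercer l l' : points01 l -> points01 l' ->
  (\sum_(0 <= k < N) mu k * mercer_coef l k * mercer_coef l' k) @[N --> \oo] -->
  ip (comb l) (comb l').
Proof.
move=> hl hl'; have Hl := rkhs_point_comb rk hl.
rewrite (ip_point_comb rk Hl hl'); elim: l' hl' => [|q l' IH] /=.
  move=> _; rewrite (_ : (fun N => _) = fun=> 0).
    by rewrite big_nil; exact: cvg_cst.
  apply/funext => N; rewrite big1// => k _.
  by rewrite /mercer_coef big_nil mulr0.
move=> /andP[q01 hl']; rewrite big_cons.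
rewrite (_ : (fun N => _) = (fun N => q.1 * \sum_(0 <= k < N) mu k * mercer_coef l k * psi k q.2
   + \sum_(0 <= k < N) mu k * mercer_coef l k * mercer_coef l' k)).
  apply: cvgD; last exact: IH.
  by apply: cvgMr; exact: point_comb_mercer.
apply/funext => N; rewrite mulr_sumr -big_split/=; apply: eq_bigr => k _.
by rewrite {2}/mercer_coef big_cons -/(mercer_coef l' k); ring.
Qed.

Lemma mercer_coef_sum_le l N : points01 l ->
  \sum_(0 <= k < N) mu k * mercer_coef l k ^+ 2 <= ip (comb l) (comb l).
Proof.
move=> hl; have h := ip_point_comb_mercer hl hl.
have -> : \sum_(0 <= k < N) mu k * mercer_coef l k ^+ 2 =
    (fun N => \sum_(0 <= k < N) mu k * mercer_coef l k * mercer_coef l k) N.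
  by apply: eq_bigr => k _; rewrite expr2 mulrA.
rewrite -(cvg_lim _ h)//; apply: nondecreasing_cvgn_le; last by apply/cvg_ex; eexists; exact: h.
apply/nondecreasing_seqP => n; rewrite big_nat_recr//= lerDl -mulrA -expr2.
by rewrite mulr_ge0 ?sqr_ge0// (mercer_ge0 me).
Qed.

Let sqi_H f : H f -> square_integrable U f.
Proof. exact: (rkhs_L2 rk). Qed.

Definition mercer_residual l d : R -> R :=
  fun x => comb l x - \sum_(0 <= k < d) mu k * mercer_coef l k * psi k x.

(** The residual is the pointwise limit of finite sums over k >= d. Their L^2 norms are
    bounded through mu_k^2 <= mu_d mu_k, since the sum of mu_k b_k^2 is the squared norm
    in H. *)
Lemma point_comb_tail l d : points01 l ->
  L2_inner U (mercer_residual l d) (mercer_residual l d) <=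
  mu d * ip (comb l) (comb l).
Proof.
move=> hl.
have psiO := mercer_orthonormal me.
have Hl := rkhs_point_comb rk hl.
pose c k := mu k * mercer_coef l k.
apply: (@L2_fatou _ (fun N x => \sum_(d <= k < N + d) c k * psi k x)).
- by move=> N; exact: square_integrable_comb.
- by apply: square_integrableB; [exact: sqi_H|exact: square_integrable_comb].
- move=> x x01; rewrite /mercer_residual.
  have h := point_comb_mercer hl x01.
  rewrite (_ : (fun N => _) = (fun N => \sum_(0 <= k < N + d) c k * psi k x
      - \sum_(0 <= k < d) c k * psi k x)); last first.
    apply/funext => N; rewrite (@big_cat_nat _ _ _ d 0 (N + d))//= ?leq_addl//.
    by rewrite addrAC subrr add0r.
  apply: cvgB; last exact: cvg_cst.
  by move: h; rewrite -(cvg_shiftn d).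
- move=> N; rewrite (L2_inner_comb_sqr psiO).
  apply: (@le_trans _ _ (mu d * \sum_(0 <= k < N + d) mu k * mercer_coef l k ^+ 2)).
    rewrite (@big_cat_nat _ _ _ d 0 (N + d))//= ?leq_addl// mulrDr.
    rewrite -[leLHS]add0r; apply: lerD.
      rewrite mulr_ge0 ?(mercer_ge0 me)// sumr_ge0// => k _.
      by rewrite mulr_ge0 ?sqr_ge0 ?(mercer_ge0 me).
    rewrite mulr_sumr big_nat [leRHS]big_nat; apply: ler_sum => k /andP[dk _].
    rewrite /c exprMn expr2 -mulrA ler_wpM2r//.
      by rewrite mulr_ge0 ?sqr_ge0 ?(mercer_ge0 me).
    exact: (mercer_noninc me).
  by rewrite ler_wpM2l ?(mercer_ge0 me)// mercer_coef_sum_le.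
Qed.

Lemma point_comb_L2_le l : points01 l ->
  L2_inner U (comb l) (comb l) <= mu 0%N * ip (comb l) (comb l).
Proof.
move=> hl; apply: le_trans (point_comb_tail 0 hl).
rewrite (_ : mercer_residual l 0 = comb l)//.
by apply/funext => x; rewrite /mercer_residual big_nil subr0.
Qed.

Section unit_ball.
Variables (g : R -> R) (Hg : H g) (g1 : ip g g <= 1).

Let approx_gap (n : nat) : R := n.+1%:R^-1.

Let gap0 n : 0 < approx_gap n.
Proof. by rewrite invr_gt0. Qed.

Let approx_ex (n : nat) : exists l, points01 l /\
  comb_dist ip K g l <= min_dist ip K g + approx_gap n ^+ 2.
Proof.
have [l hl hd] := near_minimizer_exists rk Hg (exprn_gt0 2 (gap0 n)).
by exists l.
Qed.

Let approx n : seq (R * R) := projT1 (cid (approx_ex n)).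

Let approx01 n : points01 (approx n).
Proof. by rewrite /approx; case: cid => l []. Qed.

Let approxP n : comb_dist ip K g (approx n) <= min_dist ip K g + approx_gap n ^+ 2.
Proof. by rewrite /approx; case: cid => l []. Qed.

Let err n := fun x => g x - 1 * comb (approx n) x.

Let Herr n : H (err n).
Proof. exact: (rkhsB rk 1 Hg (rkhs_point_comb rk (approx01 n))). Qed.

Let orth n l' (s : R) : points01 l' -> 0 <= s -> s ^+ 2 = ip (comb l') (comb l') ->
  `|ip (err n) (comb l')| <= approx_gap n * s.
Proof.
move=> hl' s0 sE; have := near_minimizer_orth rk Hg (approx01 n) hl' (approxP n).
rewrite -sE -exprMn -[X in X <= _]real_normK ?num_real//.
by rewrite ler_sqr ?nnegrE// mulr_ge0 ?(ltW (gap0 n)).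
Qed.

Let norm_approx n :
  ip (comb (approx n)) (comb (approx n)) <= (1 + approx_gap n) ^+ 2.
Proof.
have Hf := rkhs_point_comb rk (approx01 n); set f := comb (approx n) in Hf *.
have w0 : 0 <= ip f f by exact: (rkhs_ip_ge0 rk).
set s := Num.sqrt (ip f f).
have s0 : 0 <= s by exact: sqrtr_ge0.
have sE : s ^+ 2 = ip f f by rewrite sqr_sqrtr.
rewrite -sE ler_sqr ?nnegrE ?addr_ge0 ?(ltW (gap0 n))//.
have h1 : ip g f <= s.
  apply: le_trans (ler_norm _) _; rewrite -ler_sqr ?nnegrE// real_normK ?num_real//.
  apply: le_trans (rkhs_cauchy_schwarz rk Hg Hf) _; rewrite sE.
  by rewrite -[leRHS]mul1r ler_wpM2r.
have h2 : - ip (err n) f <= approx_gap n * s.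
  by apply: le_trans (orth n (approx01 n) s0 sE); rewrite ler_normr lexx orbT.
have h3 : ip (err n) f = ip g f - ip f f.
  rewrite /err (_ : (fun x => _) = (fun x => -1 * f x + g x)); last first.
    by apply/funext => x; rewrite mul1r mulN1r addrC.
  by rewrite (rkhs_ip_lin rk)// mulN1r addrC.
have h4 : s ^+ 2 <= (1 + approx_gap n) * s by rewrite sE; lra.
have [->|sn0] := eqVneq s 0; first by rewrite addr_ge0 ?(ltW (gap0 n)).
by move: h4; rewrite expr2 ler_pM2r// lt0r sn0.
Qed.

Let diff m n := point_comb_add (approx n) (-1) (approx m).

Let diff01 m n : points01 (diff m n).
Proof. exact: points01_add. Qed.

(** Near-minimizers form a Cauchy sequence in H: the difference of two of them is
    nearly orthogonal to both residuals, and it is the difference of these residuals. *)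
Let norm_diff m n :
  ip (comb (diff m n)) (comb (diff m n)) <= (approx_gap m + approx_gap n) ^+ 2.
Proof.
have Hd := rkhs_point_comb rk (diff01 m n); set f := comb (diff m n) in Hd *.
have w0 : 0 <= ip f f by exact: (rkhs_ip_ge0 rk).
set s := Num.sqrt (ip f f).
have s0 : 0 <= s by exact: sqrtr_ge0.
have sE : s ^+ 2 = ip f f by rewrite sqr_sqrtr.
rewrite -sE ler_sqr ?nnegrE ?addr_ge0 ?(ltW (gap0 _))//.
have h1 : ip (err m) f <= approx_gap m * s.
  by apply: le_trans (orth m (diff01 m n) s0 sE); rewrite ler_normr lexx.
have h2 : - ip (err n) f <= approx_gap n * s.
  by apply: le_trans (orth n (diff01 m n) s0 sE); rewrite ler_normr lexx orbT.
have h3 : ip f f = ip (err m) f - ip (err n) f.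
  have fE : f = (fun x => -1 * err n x + err m x).
    by rewrite /f point_comb_addE; apply/funext => x; rewrite /err; ring.
  by rewrite {1}fE (rkhs_ip_lin rk)// mulN1r addrC.
have h4 : s ^+ 2 <= (approx_gap m + approx_gap n) * s by rewrite sE; lra.
have [->|sn0] := eqVneq s 0; first by rewrite addr_ge0 ?(ltW (gap0 _)).
by move: h4; rewrite expr2 ler_pM2r// lt0r sn0.
Qed.

Let gap_cvg : approx_gap n @[n --> \oo] --> (0 : R).
Proof. exact: cvg_harmonic. Qed.

(** Near-orthogonality to a kernel section is pointwise closeness, by the reproducing
    property. *)
Let approx_cvg x : 0 <= x <= 1 -> comb (approx n) x @[n --> \oo] --> g x.
Proof.
move=> x01; have Kx := rkhs_kernel rk x01.
have pE : comb [:: (1, x)] = K^~ x.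
  by apply/funext => y; rewrite /point_comb big_seq1 mul1r.
have hx : points01 [:: (1, x)] by rewrite /points01 /= x01.
set s := Num.sqrt (ip (K^~ x) (K^~ x)).
have sE : s ^+ 2 = ip (comb [:: (1, x)]) (comb [:: (1, x)]).
  by rewrite pE sqr_sqrtr// (rkhs_ip_ge0 rk).
have h n : `|g x - comb (approx n) x| <= approx_gap n * s.
  have := orth n hx (sqrtr_ge0 _) sE.
  by rewrite pE -(rkhs_reproducing rk (Herr n) x01) /err mul1r.
apply/cvgrPdist_le => e e0.
have hs : approx_gap n * s @[n --> \oo] --> 0 * s by apply: cvgMl; exact: gap_cvg.
move: hs; rewrite mul0r => /cvgrPdist_le /(_ _ e0); apply: filterS => n.
rewrite sub0r normrN => hn; apply: le_trans (h n) _.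
by apply: le_trans (ler_norm _) hn.
Qed.

Let L2_err m : L2_inner U (err m) (err m) <= mu 0%N * (2 * approx_gap m) ^+ 2.
Proof.
apply: (@L2_fatou _ (fun n => comb (diff m (n + m)%N))).
- by move=> n; exact: sqi_H (rkhs_point_comb rk (diff01 _ _)).
- exact: sqi_H.
- move=> x x01; rewrite /err mul1r.
  under eq_fun do rewrite point_comb_addE mulN1r.
  apply: cvgB; last exact: cvg_cst.
  by have := approx_cvg x01; rewrite -(cvg_shiftn m).
- move=> n; apply: le_trans (point_comb_L2_le (diff01 _ _)) _.
  rewrite ler_wpM2l ?(mercer_ge0 me)//; apply: le_trans (norm_diff _ _) _.
  rewrite ler_sqr ?nnegrE ?addr_ge0 ?mulr_ge0 ?(ltW (gap0 _))//.
  have : approx_gap (n + m) <= approx_gap m.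
    by rewrite lef_pV2 ?posrE// ler_nat ltnS leq_addl.
  lra.
Qed.

(** The spectral tail of a combination of kernel sections is controlled by
    [point_comb_tail], and [L2_err] makes such combinations converge to g in L^2. The
    inequality [L2_inner_sqrD_le], with the approximation gap as parameter, adds the two
    contributions without spoiling the constant in front of mu_d. *)
Lemma rkhs_ball_tail d :
  L2_inner U g g - \sum_(0 <= k < d) L2_inner U (psi k) g ^+ 2 <= mu d.
Proof.
have psiO := mercer_orthonormal me.
have sg := sqi_H Hg.
set q := (X in X <= _).
have mud := mercer_ge0 me d; have mu0 := mercer_ge0 me 0.
have bnd m : q <= mu d + approx_gap m * (7 * mu d + 8 * mu 0%N).
  pose c k := mu k * mercer_coef (approx m) k.
  (* g minus the truncated expansion of [approx m] is [res] plus [err m]. *)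
  pose res := mercer_residual (approx m) d.
  have Hf := rkhs_point_comb rk (approx01 m).
  have sres : square_integrable U res.
    by apply: square_integrableB; [exact: sqi_H|exact: square_integrable_comb].
  have serr := sqi_H (Herr m).
  apply: le_trans (bessel_defect_le psiO d c sg) _.
  rewrite (_ : (fun x => _) = (fun x => res x + err m x)); last first.
    by apply/funext => x; rewrite /res /mercer_residual /err; ring.
  apply: le_trans (L2_inner_sqrD_le sres serr (gap0 m)) _.
  have h1 : L2_inner U res res <= mu d * (1 + approx_gap m) ^+ 2.
    by apply: le_trans (point_comb_tail d (approx01 m)) _; rewrite ler_wpM2l.
  have := L2_err m; have := gap0 m; set e := approx_gap m => e0 h2.
  have e1 : e <= 1 by rewrite /e /approx_gap invf_le1// ler1n.
  apply: (@le_trans _ _ ((1 + e) * (mu d * (1 + e) ^+ 2) +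
     (1 + e^-1) * (mu 0%N * (2 * e) ^+ 2))).
    apply: lerD; rewrite ler_wpM2l// addr_ge0 ?invr_ge0 ?(ltW e0)//.
  rewrite (_ : (1 + e^-1) * _ = mu 0%N * (4 * e * (e + 1))); last first.
    by field; rewrite gt_eqF.
  have h3 : mu 0%N * (4 * e * (e + 1)) <= mu 0%N * (8 * e).
    by rewrite ler_wpM2l//; nra.
  have h4 : mu d * ((1 + e) * (1 + e) ^+ 2) <= mu d * (1 + 7 * e).
    rewrite ler_wpM2l//.
    have : 0 <= e * (1 - e) by rewrite mulr_ge0 ?(ltW e0)//; lra.
    have : 0 <= e * e * (1 - e) by rewrite !mulr_ge0 ?(ltW e0)//; lra.
    nra.
  lra.
have h : (mu d + approx_gap m * (7 * mu d + 8 * mu 0%N)) @[m --> \oo] -->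
    mu d + 0 * (7 * mu d + 8 * mu 0%N).
  by apply: cvgD; [exact: cvg_cst|apply: cvgMl; exact: gap_cvg].
move: h; rewrite mul0r addr0 => h; rewrite -(cvg_lim _ h)//.
by apply: limr_ge; [apply/cvg_ex; eexists; exact: h|exact: nearW].
Qed.

End unit_ball.

End mercer_tail.

(** * Additive signals and observed coefficients *)

Section additive_signals.
Variables (R : realType) (p : nat).
Local Notation U := (lebesgue01 R).
Local Notation Q := (lebesgue_cube R p).
Variable (psi : nat -> R -> R).
Hypotheses (psiO : Defs.orthonormal U psi) (psi0 : forall k, mean_zero (psi k)).

Lemma mean_zero_integral (f : R -> R) : mean_zero f -> \int[U]_x f x = 0.
Proof. by move=> <-; apply: eq_Rintegral => x _; rewrite mulr1. Qed.

Section signal.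
Variables (S : {set 'I_p}) (g : 'I_p -> R -> R).
Hypothesis sg : forall j, j \in S -> square_integrable U (g j) /\ mean_zero (g j).
Local Notation f := (fun x : p.-tuple (measurableTypeR R) => \sum_(j in S) g j (tnth x j)).

Lemma square_integrable_additive : square_integrable Q f.
Proof.
apply: square_integrable_sum => j jS.
by apply: square_integrable_coord; have [] := sg jS.
Qed.

Lemma L2_inner_coord_additive (j : 'I_p) (h : R -> R) : square_integrable U h ->
  L2_inner Q (fun x => h (tnth x j)) f = if j \in S then L2_inner U h (g j) else 0.
Proof.
move=> sh; rewrite L2_innerC L2_inner_suml; last 2 first.
- by move=> i iS; apply: square_integrable_coord; have [] := sg iS.
- exact: square_integrable_coord.
transitivity (\sum_(i in S) if i == j then L2_inner U h (g j) else 0).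
  apply: eq_bigr => i iS; have [si zi] := sg iS; rewrite L2_innerC.
  rewrite (L2_inner_coord j i sh si (mean_zero_integral zi)) eq_sym.
  by case: eqVneq => // ->.
case: ifPn => jS; last first.
  by rewrite big1// => i iS; case: eqVneq => // ij; move: jS; rewrite -ij iS.
by rewrite (bigD1 j)//= eqxx big1 ?addr0// => i /andP[_ /negbTE ->].
Qed.

Lemma L2_inner_additive : L2_inner Q f f = \sum_(j in S) L2_inner U (g j) (g j).
Proof.
rewrite L2_inner_suml; last 2 first.
- by move=> i iS; apply: square_integrable_coord; have [] := sg iS.
- exact: square_integrable_additive.
apply: eq_bigr => j jS; rewrite L2_inner_coord_additive ?jS//.
by have [] := sg jS.
Qed.

End signal.

Section observed_coefficients.
Variable d : nat.

Lemma block_row_subproof (i : 'I_(p * d)) : (i %/ d < p)%N.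
Proof.
case: d i => [[i hi]|d' i]; first by exfalso; rewrite muln0 in hi.
by rewrite ltn_divLR.
Qed.

Definition block_row (i : 'I_(p * d)) : 'I_p := Ordinal (block_row_subproof i).

(** Index i stands for coordinate i / d and frequency i mod d, as in [block_ord]. *)
Definition coord_test (i : 'I_(p * d)) : test_function R p :=
  fun x => psi (i %% d)%N (tnth x (block_row i)).

Lemma coord_test_block (j : 'I_p) (k : 'I_d) :
  coord_test (block_ord j k) = (fun x => psi k (tnth x j)).
Proof.
apply/funext => x; rewrite /coord_test /= modnMDl modn_small//.
congr (psi k (tnth x _)); apply: val_inj => /=.
rewrite divnMDl ?(leq_ltn_trans _ (ltn_ord k))//.
by rewrite divn_small ?addn0.
Qed.

Lemma orthonormal_coord_test : Defs.orthonormal Q coord_test.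
Proof.
have [spsi opsi] := psiO; split.
  by move=> i; exact: square_integrable_coord.
move=> i i'; rewrite (L2_inner_coord _ _ (spsi _) (spsi _) (mean_zero_integral (psi0 _))).
have -> : (i == i') = (block_row i == block_row i') && (i %% d == i' %% d)%N.
  apply/eqP/andP => [->//|[/eqP/(congr1 val)/= h1 /eqP h2]].
  by apply: val_inj; rewrite /= (divn_eq i d) (divn_eq i' d) h1 h2.
by case: eqP => _; rewrite /= ?opsi.
Qed.

Variables (n : nat) (disp : measure_display) (Omega : measurableType disp).
Variables (P : probability Omega R) (B : test_function R p -> Omega -> R).
Hypotheses (n0 : (0 < n)%N) (wn : is_white_noise P B).

Lemma T_stat_trunc_stat (r : R) (f : test_function R p) (w : Omega) :
  T_stat n psi r d (signal_plus_noise n B f w) =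
  trunc_stat r (fun j k => Num.sqrt n%:R * L2_inner Q (fun x => psi k (tnth x j)) f)
    [tuple B (coord_test i) w | i < p * d].
Proof.
rewrite /T_stat /trunc_stat; apply: eq_bigr => j _.
suff -> : energy n psi d (signal_plus_noise n B f w) j =
    shifted_sq_norm (fun k => Num.sqrt n%:R * L2_inner Q (fun x => psi k (tnth x j)) f)
      (pick_coords (block_ord j) [tuple B (coord_test i) w | i < p * d]) by [].
rewrite /energy /shifted_sq_norm mulr_sumr; apply: eq_bigr => k _.
rewrite /pick_coords !tnth_mktuple coord_test_block /coef /signal_plus_noise.
have s0 : Num.sqrt n%:R != 0 :> R by rewrite gt_eqF// sqrtr_gt0 ltr0n.
have nE : n%:R = Num.sqrt n%:R ^+ 2 :> R by rewrite sqr_sqrtr.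
set y := L2_inner _ _ _; set z := B _ _.
by rewrite {1}nE; field.
Qed.

Lemma law_obs_trunc_stat (r : R) (f : test_function R p) (E : set R) : measurable E ->
  law_obs P n B f [set Y | E (T_stat n psi r d Y)] =
  std_gaussian R (p * d)
    [set x | E (trunc_stat r (fun j k => Num.sqrt n%:R *
       L2_inner Q (fun x => psi k (tnth x j)) f) x)].
Proof.
move=> mE; rewrite -(white_noise_gaussian wn orthonormal_coord_test).
  by congr (P _); apply/seteqP; split => w /=; rewrite T_stat_trunc_stat.
rewrite -[X in measurable X]setTI; exact: measurable_trunc_stat.
Qed.

End observed_coefficients.

End additive_signals.

(** * Error probabilities of the test *)

Lemma half_le_ln (R : realType) (x : R) : 2 <= x -> 2^-1 <= ln x.
Proof.
move=> x2; have x0 : 0 < x by lra.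
rewrite -ler_expR (lnK x0).
have h := expR_ge1Dx (- 2^-1 : R).
have e0 := expR_gt0 (2^-1 : R).
have : expR (2^-1) * expR (- 2^-1) = 1 :> R by rewrite expRxMexpNx_1.
nra.
Qed.

(** With exp (- L) = 1 / (1 + p / s^2), the product p exp (- L) / s^2 is at most 1: the
    p coordinates without signal cost a bounded amount at a Chernoff parameter of order
    1 / s. *)
Lemma null_budget (R : realType) (p s cm delta rho : R) :
  0 <= p -> 0 < s -> 0 <= cm -> 0 < delta -> 0 < rho -> 2^-1 <= rho * delta ->
  p * ((2 * s * rho)^-1 ^+ 2 * (cm / delta ^+ 2 * (1 + p / s ^+ 2)^-1)) <= cm.
Proof.
move=> p0 s0 cm0 delta0 rho0 h.
have s20 : 0 < s ^+ 2 by rewrite exprn_gt0.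
have -> : p * ((2 * s * rho)^-1 ^+ 2 * (cm / delta ^+ 2 * (1 + p / s ^+ 2)^-1)) =
    cm * (p / (s ^+ 2 + p)) * (2 * (rho * delta))^-1 ^+ 2.
  have h1 : s ^+ 2 + p != 0 by rewrite gt_eqF// ltr_wpDr.
  by field; rewrite h1 !gt_eqF.
rewrite -mulrA -[leRHS]mulr1 ler_wpM2l// -[leRHS]mulr1.
apply: ler_pM; rewrite ?sqr_ge0 ?divr_ge0 ?addr_ge0 ?(ltW s20)//.
  by rewrite ler_pdivrMr ?ltr_wpDr// mul1r lerDr ltW.
rewrite expr_le1//; last by rewrite invr_ge0 !mulr_ge0 ?ltW.
by rewrite invf_le1; lra.
Qed.

Section test_errors.
Variables (R : realType) (p n s nu : nat).
Variables (disp : measure_display) (Omega : measurableType disp).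
Variables (P : probability Omega R) (B : test_function R p -> Omega -> R).
Variables (H : set (R -> R)) (ip : (R -> R) -> (R -> R) -> R).
Variables (K0 : R -> R -> R) (mu : nat -> R) (psi : nat -> R -> R) (r C : R).
Hypotheses (wn : is_white_noise P B) (rk0 : is_RKHS (centered H) ip K0).
Hypotheses (me : mercer_expansion K0 mu psi) (psi0 : forall k, mean_zero (psi k)).
Hypotheses (n0 : (0 < n)%N) (s1 : (1 <= s)%N) (sp : s%:R < Num.sqrt (p%:R : R)).
Hypothesis trunc : is_truncation_level mu p s n nu.
Local Notation L := (log_term R p s).
Local Notation rho := (Num.sqrt (nu%:R * L)).
Hypotheses (LK : L <= 800^-1 ^+ 2 * nu%:R) (r2 : r ^+ 2 = 49 * rho).
Local Notation Q := (lebesgue_cube R p).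

Let sR0 : 0 < s%:R :> R. Proof. by rewrite ltr0n. Qed.

Let nu0 : 0 < nu%:R :> R. Proof. by rewrite ltr0n; case: trunc. Qed.

Let ratio_ge1 : 1 <= p%:R / s%:R ^+ 2 :> R.
Proof.
rewrite ler_pdivlMr ?exprn_gt0// mul1r ltW//.
rewrite -[ltRHS](@sqr_sqrtr _ p%:R)//.
by rewrite ltr_pXn2r ?nnegrE ?ler0n ?sqrtr_ge0.
Qed.

Let L2 : 2^-1 <= L.
Proof. by apply: half_le_ln; move: ratio_ge1; lra. Qed.

Let expRNL : expR (- L) = (1 + p%:R / s%:R ^+ 2)^-1.
Proof. by rewrite expRN /log_term lnK// posrE; move: ratio_ge1; lra. Qed.

Let L0 : 0 < L. Proof. by move: L2; lra. Qed.

Let rho0 : 0 < rho. Proof. by rewrite sqrtr_gt0 mulr_gt0. Qed.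

Let rho2 : rho ^+ 2 = nu%:R * L. Proof. by rewrite sqr_sqrtr// mulr_ge0 ?ltW. Qed.

Let delta := rho / nu%:R.

Let delta0 : 0 < delta. Proof. by rewrite divr_gt0. Qed.

Let deltaM : delta * nu%:R = rho. Proof. by rewrite divfK// gt_eqF. Qed.

Let delta2 : delta ^+ 2 * nu%:R = L.
Proof. by rewrite expr2 -mulrA deltaM mulrAC -expr2 rho2 mulrAC divff ?mul1r// gt_eqF. Qed.

Let delta_le : delta <= 800^-1.
Proof.
have d0 : delta \is Num.nneg by rewrite nnegrE ltW.
have k0 : 800^-1 \is @Num.nneg R by rewrite nnegrE invr_ge0 ler0n.
rewrite -(ler_sqr d0 k0) -(ler_pM2r nu0) delta2; exact: LK.
Qed.

Let r2' : r ^+ 2 = 49 * (delta * nu%:R). Proof. by rewrite deltaM. Qed.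

Let L2' : 2^-1 <= delta ^+ 2 * nu%:R. Proof. by rewrite delta2. Qed.

Let rho_delta : 2^-1 <= rho * delta.
Proof. by rewrite -deltaM mulrAC -expr2. Qed.

(** The Chernoff parameter of both error bounds: l times the threshold is C / 2, while
    the s active coordinates lose a bounded amount, of order s l rho. *)
Let l := (2 * s%:R * rho)^-1.

Let l0 : 0 < l. Proof. by rewrite invr_gt0 !mulr_gt0. Qed.

Let s_ge1 : 1 <= s%:R :> R. Proof. by rewrite ler1n. Qed.

Let l_delta : l <= delta.
Proof.
rewrite -[leLHS]mulr1 ler_pdivrMl ?mulr_gt0// -mulrA.
have : 1 * 2^-1 <= s%:R * (rho * delta) by apply: ler_pM => //; rewrite invr_ge0.
lra.
Qed.

Let l_rho : l * (delta * nu%:R) <= 2^-1.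
Proof.
rewrite deltaM /l invfM -mulrA mulVf ?gt_eqF// mulr1 invfM ler_piMr ?invr_ge0//.
by rewrite invf_le1.
Qed.

Let null_cost :
  p%:R * (l ^+ 2 * (mgf_const R / delta ^+ 2 * expR (- (delta ^+ 2 * nu%:R)))) <= mgf_const R.
Proof.
by rewrite delta2 expRNL; apply: null_budget => //; exact: ltW (mgf_const_gt0 R).
Qed.

Let l_threshold : l * (C * (s%:R * rho)) = C / 2.
Proof. by rewrite /l; field; rewrite !gt_eqF. Qed.

Lemma false_alarm_bound :
  (law_obs P n B (fun=> 0%R) [set Y | (C * (s%:R * rho) < T_stat n psi r nu Y)%R]
   <= (expR (mgf_const R - C / 2))%:E)%E.
Proof.
have mE : measurable [set y : R | C * (s%:R * rho) < y].
  by rewrite -set_itvoy; exact: measurable_itv.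
have -> := law_obs_trunc_stat (mercer_orthonormal me) psi0 nu n0 wn r (fun=> 0) mE.
rewrite (_ : (fun j k => _) = (fun (_ : 'I_p) (_ : 'I_nu) => 0)); last first.
  by apply/funext => j; apply/funext => k; rewrite L2_innerC L2_inner0l mulr0.
apply: le_trans (trunc_stat_null_tail p delta0 delta_le L2' r2' l0 l_delta l_rho _) _.
by rewrite lee_fin ler_expR l_threshold lerD2r.
Qed.

(** Cutting at frequency nu loses at most mu_nu <= rho / n for each active component, so
    the standardized coefficients retain an energy of at least (C^2 - 1) s rho. This
    quadratic growth in C beats the linear term C / 2 due to the threshold. *)
Lemma missed_detection_bound (f : test_function R p) :
  sparse_additive_class (centered H) ip s f ->
  C ^+ 2 * (s%:R * rho) <= n%:R * L2_inner Q f f ->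
  (law_obs P n B f [set Y | (T_stat n psi r nu Y <= C * (s%:R * rho))%R]
   <= (expR (alpha_const R / 2 + 1 + mgf_const R + C / 2 - (C ^+ 2 - 1) / 4))%:E)%E.
Proof.
move=> [S Ss [g gS fE]] Cf.
have {f fE Cf} [-> Cf] : f = (fun x => \sum_(j in S) g j (tnth x j)) /\
    C ^+ 2 * (s%:R * rho) <= n%:R *
      L2_inner Q (fun x => \sum_(j in S) g j (tnth x j)) (fun x => \sum_(j in S) g j (tnth x j)).
  by have <- : f = (fun x => \sum_(j in S) g j (tnth x j)) by exact/funext.
have sg j : j \in S -> square_integrable (lebesgue01 R) (g j) /\ mean_zero (g j).
  by move=> jS; have [Hg _] := gS j jS; split; [exact: (rkhs_L2 rk0)|exact: Hg.2].
have [spsi _] := mercer_orthonormal me.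
have mE : measurable [set y : R | y <= C * (s%:R * rho)].
  by rewrite -set_itvNyc; exact: measurable_itv.
have -> := law_obs_trunc_stat (mercer_orthonormal me) psi0 nu n0 wn r _ mE.
set m := (fun j k => _) : 'I_p -> 'I_nu -> R.
have mS j k : j \notin S -> m j k = 0.
  by move=> /negbTE jS; rewrite /m (L2_inner_coord_additive sg) ?jS ?mulr0.
apply: le_trans (trunc_stat_signal_tail delta0 delta_le L2' r2' l0 l_delta l_rho _ mS) _.
rewrite lee_fin ler_expR l_threshold deltaM.
have [_ below _] := trunc.
have tail j : j \in S ->
    n%:R * L2_inner (lebesgue01 R) (g j) (g j) - rho <= \sum_(k < nu) m j k ^+ 2.
  move=> jS; have [Hg g1] := gS j jS.
  have g1' : ip (g j) (g j) <= 1.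
    rewrite -(sqr_sqrtr (rkhs_ip_ge0 rk0 Hg)) -[leRHS](expr1n _ 2).
    by rewrite ler_sqr ?nnegrE ?sqrtr_ge0.
  have := rkhs_ball_tail rk0 me Hg g1' nu; rewrite big_mkord.
  have munu : mu nu <= rho / n%:R.
    by apply: le_trans below; apply: (mercer_noninc me); exact: leq_pred.
  have -> : \sum_(k < nu) m j k ^+ 2 =
      n%:R * \sum_(k < nu) L2_inner (lebesgue01 R) (psi k) (g j) ^+ 2.
    rewrite mulr_sumr; apply: eq_bigr => k _.
    by rewrite /m (L2_inner_coord_additive sg) ?jS// exprMn sqr_sqrtr.
  set q := \sum_(k < nu) _ => h.
  have nR0 : 0 < n%:R :> R by rewrite ltr0n.
  have : n%:R * (L2_inner (lebesgue01 R) (g j) (g j) - q) <= n%:R * (rho / n%:R).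
    by rewrite ler_wpM2l ?(ltW nR0)//; apply: le_trans h munu.
  by rewrite mulrCA divff ?gt_eqF//; lra.
have Lam : (C ^+ 2 - 1) * (s%:R * rho) <= \sum_(j in S) \sum_(k < nu) m j k ^+ 2.
  apply: (@le_trans _ _ (\sum_(j in S) (n%:R * L2_inner (lebesgue01 R) (g j) (g j) - rho))).
    rewrite sumrB -mulr_sumr -(L2_inner_additive sg) sumr_const -mulr_natl.
    have : #|S|%:R * rho <= s%:R * rho by rewrite ler_wpM2r ?(ltW rho0)// ler_nat.
    lra.
  exact: ler_sum.
have h1 : (C ^+ 2 - 1) / 2 <= l * \sum_(j in S) \sum_(k < nu) m j k ^+ 2.
  apply: le_trans (_ : l * ((C ^+ 2 - 1) * (s%:R * rho)) <= _); last first.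
    by rewrite ler_wpM2l ?(ltW l0).
  by rewrite le_eqVlt /l; apply/orP; left; apply/eqP; field; rewrite !gt_eqF.
have h2 : #|S|%:R * (l * (alpha_const R * rho) + 2 * l ^+ 2 * nu%:R) <=
    alpha_const R / 2 + 1.
  have a0 := alpha_const_gt0 R; move: (alpha_const R) a0 => a a0.
  apply: (@le_trans _ _ (s%:R * (l * (a * rho) + 2 * l ^+ 2 * nu%:R))).
    by rewrite ler_wpM2r ?ler_nat// addr_ge0 ?mulr_ge0 ?sqr_ge0 ?(ltW l0) ?(ltW a0).
  have -> : s%:R * (l * (a * rho) + 2 * l ^+ 2 * nu%:R) =
      a / 2 + (2 * (s%:R * (rho * delta)))^-1.
    by rewrite /l /delta; field; rewrite !gt_eqF.
  rewrite lerD2l invf_le1; last by rewrite mulr_gt0// mulr_gt0// mulr_gt0.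
  have : 1 * 2^-1 <= s%:R * (rho * delta) by apply: ler_pM => //; rewrite invr_ge0.
  lra.
have := null_cost; lra.
Qed.

End test_errors.

(** Once C >= 4, the gain C^2 / 4 is at least C and both exponents decrease linearly
    in C. *)
Lemma detection_threshold (R : realType) (Q eta cm C : R) : 0 < eta -> 0 <= cm <= Q ->
  4 + 2 * (Q + 1 + `|ln (eta / 2)|) < C ->
  expR (cm - C / 2) <= eta / 2 /\
  expR (Q + C / 2 - (C ^+ 2 - 1) / 4) <= eta / 2.
Proof.
move=> eta0 /andP[cm0 cmQ] hC.
have e20 : 0 < eta / 2 by rewrite divr_gt0.
have hl : - `|ln (eta / 2)| <= ln (eta / 2) by rewrite lerNl -normrN ler_norm.
have n0 := normr_ge0 (ln (eta / 2)).
have vE : expR (ln (eta / 2)) = eta / 2 by exact: lnK.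
move: (ln _) vE hl n0 hC => v <- hl n0 hC.
rewrite !ler_expR; split; first by lra.
have : 0 <= C * (C - 4) by rewrite mulr_ge0; lra.
lra.
Qed.

Theorem proposition2 (R : realType) :
  exists D K1 K2 K3 : R,
    [/\ 0 < D, 0 < K1, 0 < K2 & 0 < K3] /\
    forall eta : R, 0 < eta < 1 ->
    exists2 Ceta : R, 0 < Ceta &
    forall (p n s : nat)
      (dO : measure_display) (Omega : measurableType dO)
      (P : probability Omega R) (B : test_function R p -> Omega -> R)
      (H : set (R -> R)) (ip : (R -> R) -> (R -> R) -> R)
      (K K0 : R -> R -> R) (lambda mu : nat -> R) (phi psi : nat -> R -> R)
      (nu : nat),
    is_white_noise P B ->
    is_RKHS H ip K -> mercer_expansion K lambda phi ->
    is_RKHS (centered H) ip K0 -> mercer_expansion K0 mu psi ->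
    (forall k, mean_zero (psi k)) -> mu 0%N = 1 ->
    (0 < n)%N -> (1 <= s)%N -> s%:R < Num.sqrt (p%:R : R) ->
    is_truncation_level mu p s n nu ->
    let d := maxn nu `|Num.ceil D|%N in
    let L : R := log_term R p s in
    let tau : R := Num.sqrt (s%:R * Num.sqrt (nu%:R * L) / n%:R) in
    let r : R := K2 * (d%:R * L) `^ 4^-1 in
    L <= K3 ^+ 2 * d%:R ->
    forall C : R, Ceta < C ->
    let t : R := C * K1 * n%:R * tau ^+ 2 in
    (law_obs P n B (fun=> 0%R) [set Y | (t < T_stat n psi r d Y)%R]
     + ereal_sup ([set 0] `|`
         [set law_obs P n B f [set Y | (T_stat n psi r d Y <= t)%R]
            | f in [set f | sparse_additive_class (centered H) ip s f /\
                            (C * tau)%R%:E <= L2_norm (lebesgue_cube R p) f]])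
     <= eta%:E)%E.
Proof.
pose Q : R := alpha_const R / 2 + 1 + mgf_const R.
exists 1, 1, 7, 800^-1; split; first by split; lra.
move=> eta /andP[eta0 _].
have cm0 := mgf_const_gt0 R; have ca0 := alpha_const_gt0 R.
have Q0 : 0 <= mgf_const R <= Q by rewrite ltW//= /Q; lra.
exists (4 + 2 * (Q + 1 + `|ln (eta / 2)|)).
  by have := normr_ge0 (ln (eta / 2)); move: Q0 => /andP[]; lra.
move=> p n s dO Omega P B H ip K K0 lambda mu phi psi nu wn _ _ rk0 me psi0 _ n0 s1 sp tr d L tau r LK C hC.
cbv zeta.
have nu0 : (0 < nu)%N by case: tr.
have dE : d = nu by rewrite /d ceil1; apply/maxn_idPl.
have nuL0 : 0 <= nu%:R * L.
  rewrite mulr_ge0// ln_ge0// lerDl divr_ge0// exprn_ge0//.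
have r2 : r ^+ 2 = 49 * Num.sqrt (nu%:R * L).
  rewrite /r dE exprMn -[X in _ * X]powR_mulrn ?powR_ge0// -powRrM.
  rewrite (_ : 4^-1 * 2 = 2^-1 :> R); last by field.
  by rewrite powR12_sqrt//; congr (_ * _); ring.
have nR0 : 0 < n%:R :> R by rewrite ltr0n.
have tau2 : n%:R * tau ^+ 2 = s%:R * Num.sqrt (nu%:R * L).
  rewrite /tau sqr_sqrtr ?divr_ge0 ?mulr_ge0 ?sqrtr_ge0//.
  by rewrite mulrCA mulfV ?mulr1// gt_eqF.
have tE : C * 1 * n%:R * tau ^+ 2 = C * (s%:R * Num.sqrt (nu%:R * L)).
  by rewrite mulr1 -mulrA tau2.
rewrite dE in LK.
have [err1 err2] := detection_threshold eta0 Q0 hC.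
have C0 : 0 <= C.
  apply: le_trans (ltW hC); have := normr_ge0 (ln (eta / 2)).
  by move: Q0 => /andP[]; lra.
rewrite dE tE [eta]splitr EFinD; apply: leeD.
  apply: le_trans (false_alarm_bound C wn me psi0 n0 s1 sp tr LK r2) _.
  by rewrite lee_fin.
apply: ge_ereal_sup => _ [->|[f [fF fC] <-]].
  by rewrite lee_fin divr_ge0// ltW.
have sf : square_integrable (lebesgue_cube R p) f.
  have [S _ [g gS fE]] := fF.
  rewrite (_ : f = (fun x => \sum_(j in S) g j (tnth x j))); last exact/funext.
  apply: square_integrable_additive => j jS; have [Hg _] := gS j jS.
  by split; [exact: (rkhs_L2 rk0)|exact: Hg.2].
have Cf : C ^+ 2 * (s%:R * Num.sqrt (nu%:R * L)) <=
    n%:R * L2_inner (lebesgue_cube R p) f f.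
  have tau0 : 0 <= tau by exact: sqrtr_ge0.
  have := L2_norm_sqr_ge sf (mulr_ge0 C0 tau0) fC.
  rewrite exprMn -tau2 => h.
  rewrite (_ : C ^+ 2 * (n%:R * tau ^+ 2) = n%:R * (C ^+ 2 * tau ^+ 2)); last by ring.
  by apply: ler_wpM2l; [exact: ltW|exact: h].
apply: le_trans (missed_detection_bound wn rk0 me psi0 n0 s1 sp tr LK r2 fF Cf) _.
by rewrite lee_fin.
Qed.
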